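(* Fix $m,n\in\mathbb N$ with $m>2$. Let $\mathbf y\in\mathbb R^m$ and $P(\mathbf q)=\mathbf y+\mathbb Z^m$ for every $\mathbf q\in\mathbb Z^n$, and let $\psi:\mathbb Z^n\to\mathbb R_+$. Then \[\mathrm{Leb}(W_{n,m}^P(\psi))=\begin{cases}0&\text{if }\sum_{\mathbf q\in\mathbb Z^n}\psi(\mathbf q)^m<\infty,\\ 1&\text{if }\sum_{\mathbf q\in\mathbb Z^n}\psi(\mathbf q)^m=\infty.\end{cases}\]
   Context: $\mathbb R_+$ denotes the nonnegative reals; $|\cdot|$ is the maximum norm and $B(\mathbf 0,r)$ the ball of radius $r$ in it. $W_{n,m}^P(\psi)$ is the set of $\mathbf X\in\mathbb T^{nm}=M_{n\times m}(\mathbb R)/M_{n\times m}(\mathbb Z)$ such that $\mathbf q\mathbf X\in B(\mathbf 0,\psi(\mathbf q))+P(\mathbf q)$ for infinitely many $\mathbf q\in\mathbb Z^n$ ($\mathbf q$ a row vector); the condition is $\mathbb Z^{nm}$-periodic in $\mathbf X$. *)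

(* Defs.v *)
From HB Require Import structures.
From mathcomp Require Import all_boot all_order all_algebra.
From mathcomp Require Import all_classical all_reals all_analysis.
Set Implicit Arguments.
Unset Strict Implicit.
Unset Printing Implicit Defensive.
Import Order.TTheory GRing.Theory Num.Theory.
Import numFieldNormedType.Exports.
Local Open Scope classical_set_scope.
Local Open Scope ring_scope.
Local Open Scope quotient_scope.

(* Lebesgue measure on R^d, as the iterated product of [lebesgue_measure] along
   R^(d+1) = R * R^d. *)
Fixpoint lebesgue_tuple (R : realType) (d : nat) : set (d.-tuple R) -> \bar R :=
  match d with
  | 0 => dirac [tuple]
  | d'.+1 => pushforward
      (@lebesgue_measure R \x @lebesgue_tuple R d')%E
      (fun p : R * d'.-tuple R => [tuple of p.1 :: p.2])
  end.
Arguments lebesgue_tuple : clear implicits.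

Section lebesgue_tuple_measure.
Context (R : realType).

Let lebesgue_tuple_sfm (d : nat) :
  exists mu : {sigma_finite_measure set (d.-tuple R) -> \bar R},
    lebesgue_tuple R d = mu.
Proof.
elim: d => [|d [mu mudE]]; first by exists (dirac [tuple]).
pose f := fun p : R * d.-tuple R => [tuple of p.1 :: p.2].
have mf : measurable_fun [set: R * d.-tuple R] f.
  exact: (@measurable_cons _ _ _ _ fst d snd).
pose g := fun t : d.+1.-tuple R => (thead t, [tuple of behead t]).
have mg : measurable_fun [set: d.+1.-tuple R] g.
  apply/measurable_fun_pairP; split; first exact: measurable_tnth.
  exact: measurable_behead.
have gK : cancel g f by move=> t; rewrite /f /g /= -tuple_eta.
have fK : cancel f g.
  by move=> [x t]; rewrite /f /g /= theadE; congr pair; apply/val_inj.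
pose nu : {measure set (d.+1.-tuple R) -> \bar R} :=
  measure_function_pushforward__canonical__measure_function_Measure
    (@lebesgue_measure R \x mu)%E mf.
have snu : sigma_finite setT nu.
  have /sigma_finiteP[F [FT ndF Foo]] := sigma_finiteT (@lebesgue_measure R).
  have /sigma_finiteP[G [GT ndG Goo]] := sigma_finiteT mu.
  exists (fun i => g @^-1` (F i `*` G i)).
    rewrite -preimage_bigcup (_ : \bigcup_i _ = setT) ?preimage_setT//.
    rewrite predeqE => -[x y]; split=> // _.
    have [k _ Fkx] : (\bigcup_i F i) x by rewrite -FT.
    have [l _ Gly] : (\bigcup_i G i) y by rewrite -GT.
    exists (maxn k l) => //; split.
    - by move: x Fkx; exact/subsetPset/ndF/leq_maxl.
    - by move: y Gly; exact/subsetPset/ndG/leq_maxr.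
  move=> i; have [mFi Fioo] := Foo i; have [mGi Gioo] := Goo i; split.
    by rewrite -[X in measurable X]setTI; apply: mg => //; exact: measurableX.
  rewrite /nu /= /pushforward -comp_preimage (_ : g \o f = id).
    by rewrite product_measure1E// lte_mul_pinfty// ge0_fin_numE.
  by apply/funext => p /=; rewrite fK.
exists (HB.pack_for {sigma_finite_measure set (d.+1.-tuple R) -> \bar R}
  (nu : _ -> _) (Measure.on nu) (@Measure_isSigmaFinite.Build _ _ _ nu snu)).
by rewrite /= mudE.
Qed.

Let lebesgue_tuple0 d : lebesgue_tuple R d set0 = 0%E.
Proof. by have [mu ->] := lebesgue_tuple_sfm d; exact: measure0. Qed.

Let lebesgue_tuple_ge0 d A : (0 <= lebesgue_tuple R d A)%E.
Proof. by have [mu ->] := lebesgue_tuple_sfm d; exact: measure_ge0. Qed.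

Let lebesgue_tuple_sigma_additive d :
  semi_sigma_additive (lebesgue_tuple R d).
Proof.
by have [mu ->] := lebesgue_tuple_sfm d; exact: measure_semi_sigma_additive.
Qed.

HB.instance Definition _ d := isMeasure.Build _ _ _ (lebesgue_tuple R d)
  (lebesgue_tuple0 d) (@lebesgue_tuple_ge0 d) (@lebesgue_tuple_sigma_additive d).

Let lebesgue_tuple_sigma_finite d : sigma_finite setT (lebesgue_tuple R d).
Proof. by have [mu ->] := lebesgue_tuple_sfm d; exact: sigma_finiteT. Qed.

HB.instance Definition _ d := Measure_isSigmaFinite.Build _ _ _
  (lebesgue_tuple R d) (lebesgue_tuple_sigma_finite d).

Lemma measurable_tuple_box d (A : 'I_d -> set R) :
  (forall i, measurable (A i)) ->
  measurable [set t : d.-tuple R | forall i, A i (tnth t i)].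
Proof.
move=> mA.
rewrite (_ : [set _ | _] =
    \bigcap_(i in [set: 'I_d]) ((fun t => tnth t i) @^-1` A i)).
  apply: fin_bigcap_measurable => [|i _]; first exact: finite_finset.
  by rewrite -[X in measurable X]setTI; exact: measurable_tnth.
by apply/seteqP; split => t /= At i; [move=> _|]; exact: At.
Qed.

Lemma lebesgue_tuple_box d (A : 'I_d -> set R) :
  (forall i, measurable (A i)) ->
  lebesgue_tuple R d [set t | forall i, A i (tnth t i)] =
  (\prod_(i < d) lebesgue_measure (A i))%E.
Proof.
elim: d A => [|d IH] A mA.
  rewrite big_ord0 /= diracE mem_set//= => -[].
by move=> ? //.
pose f := fun p : R * d.-tuple R => [tuple of p.1 :: p.2].
have fE : f @^-1` [set t | forall i, A i (tnth t i)] =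
    A ord0 `*` [set t | forall i, A (lift ord0 i) (tnth t i)].
  apply/seteqP; split => -[x t] /=.
    move=> At; split; first exact: (At ord0).
    by move=> i; have := At (lift ord0 i); rewrite tnthS.
  move=> [Ax At] i; case: (unliftP ord0 i) => [j ->|->//].
  by rewrite tnthS.
rewrite big_ord_recl -IH//= /pushforward fE product_measure1E//.
  exact: (mA ord0).
exact: (@measurable_tuple_box d (fun i => A (lift ord0 i))).
Qed.

End lebesgue_tuple_measure.

Section torus.
Context (R : realType) (n m : nat).
Implicit Types X Y : 'M[R]_(n, m).

Definition eqmodZ X Y : bool := X - Y \is a mxOver Num.int.

Let eqmodZ_refl : reflexive eqmodZ.
Proof. by move=> X; apply/mxOverP => i j; rewrite subrr mxE rpred0. Qed.

Let eqmodZ_sym : symmetric eqmodZ.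
Proof.
by move=> X Y; apply/mxOverP/mxOverP => XY i j; have := XY i j;
  rewrite !mxE -rpredN opprB.
Qed.

Let eqmodZ_trans : transitive eqmodZ.
Proof.
move=> Y X Z /mxOverP XY /mxOverP YZ; apply/mxOverP => i j.
by have := rpredD (XY i j) (YZ i j); rewrite !mxE subrKA.
Qed.

Canonical eqmodZ_equiv := EquivRel eqmodZ eqmodZ_refl eqmodZ_sym eqmodZ_trans.

Definition torus := {eq_quot eqmodZ}.
HB.instance Definition _ := Choice.on torus.
HB.instance Definition _ := EqQuotient.on torus.

Definition mx_of_tuple (t : (n * m).-tuple R) : 'M[R]_(n, m) :=
  vec_mx (\row_i tnth t i).

(* Lebesgue measure on the torus: the image of Lebesgue measure on the
   fundamental domain [0, 1[^(n * m) under the projection. *)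
Definition lebesgue_torus (E : set torus) : \bar R :=
  lebesgue_tuple R (n * m)
    [set t | (forall i, tnth t i \in `[0, 1[) /\ E (\pi_torus (mx_of_tuple t))].

Lemma lebesgue_torusT : lebesgue_torus setT = 1%E.
Proof.
pose A (i : 'I_(n * m)) : set R := [set` `[0, 1[].
have mA i : measurable (A i) by exact: measurable_itv.
rewrite /lebesgue_torus (_ : [set _ | _] = [set t | forall i, A i (tnth t i)]).
  rewrite lebesgue_tuple_box//; apply: big1 => i _.
  by rewrite lebesgue_measure_itv/= lte_fin ltr01 oppr0 adde0.
by apply/seteqP; split => t /= => [[]|].
Qed.

(* The ball is open and taken for the maximum norm. *)
Definition W (P : 'rV[int]_n -> set 'rV[R]_m) (psi : 'rV[int]_n -> R) :
    set torus :=
  \pi_torus @` [set X | infinite_set [set q : 'rV[int]_n |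
    [set u + v | u in ball 0 (psi q) & v in P q] (map_mx intr q *m X)]].

End torus.

Definition shifted_lattice (R : realType) (m : nat) (y : 'rV[R]_m) :
    set 'rV[R]_m :=
  [set y + map_mx intr p | p in [set: 'rV[int]_m]].

(* Main.v *)
Require Import Defs.
From HB Require Import structures.
From mathcomp Require Import all_boot all_order all_algebra.
From mathcomp Require Import all_classical all_reals all_analysis.
From mathcomp Require Import measurable_realfun ring lra zify.
Set Implicit Arguments.
Unset Strict Implicit.
Unset Printing Implicit Defensive.
Import Order.TTheory GRing.Theory Num.Theory.
Import numFieldNormedType.Exports.
Local Open Scope classical_set_scope.
Local Open Scope ring_scope.

(* The convergent half is the Borel-Cantelli lemma. For the divergent half one may
   assume psi <= 1/2. Let A_q be the set of X with |q X - y - p| < psi(q) for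
   some integer vector p. If every translation of q' X is realised, up to a small
   error, by a translation of X that preserves A_q, then integrating over all
   translations shows that A_q is independent, up to that error, of any event on
   q' X. This gives |A_q|, the independence of A_q and A_q' for non-proportional
   q and q', the bound |A_q /\ A_q'| << |A_q| (psi(q')^m + a^-m) when
   a q' = b q in lowest terms, and the mixing of A_q with any fixed set as
   |q| -> oo.

   In a proportional pair one may assume |b| <= a; then a and b determine q'
   from q, so these pairs contribute at most sum_a a * a^-m times |A_q|, which
   converges because m > 2. Hence the second moment of a finite sum of
   indicators of the A_q is << V^2 + V, where V is the sum of the |A_q|.

   No zero-one law is needed to pass to full measure. Let E be the complement of
   the union of the A_q over all but finitely many q, and let E_r decrease to E
   as r -> 0. Mixing gives |E| V <= sum_q |A_q /\ (E_r \ E)| as the A_q avoid E,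
   and by the second moment bound the right-hand side is << V |E_r \ E|^(1/2).
   Thus |E| = 0. *)

(** * Translations of the torus *)

Section lebesgue_translation.
Context {R : realType}.
Local Notation mu := (@lebesgue_measure R).

Lemma preimage_addr_ocitv (a b z : R) :
  (fun x => x + z) @^-1` `]a, b] = `]a - z, b - z]%classic.
Proof.
by apply/seteqP; split => x /=; rewrite !in_itv/= ltrBlDr lerBrDr.
Qed.

Lemma lebesgue_measure_addr (z : R) (A : set R) : measurable A ->
  pushforward mu ((fun x => x + z) : _ -> measurableTypeR R) A = mu A.
Proof.
move=> mA; apply/esym/lebesgue_measure_unique => //=.
  exact: measurable_funD.
move=> _ _ [[a b]] _ <-.
rewrite /pushforward preimage_addr_ocitv !lebesgue_measure_itv/=.
by rewrite !lte_fin ltrD2r -!EFinB opprB addrA subrK.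
Qed.

Lemma ge0_integral_addr (z : R) (D : set R) (f : R -> \bar R) :
  measurable D -> measurable_fun setT f -> (forall x, 0 <= f x)%E ->
  (\int[mu]_(x in (fun x => (x + z)%R) @^-1` D) f (x + z)%R =
   \int[mu]_(x in D) f x)%E.
Proof.
move=> mD mf f0.
pose s : measurableTypeR R -> measurableTypeR R := fun x => x + z.
have ms : measurable_fun [set: measurableTypeR R] s by exact: measurable_funD.
rewrite -[LHS]/(\int[mu]_(x in s @^-1` D) (f \o s) x)%E.
rewrite -(ge0_integral_pushforward ms)//=; last exact: measurable_funS mf.
by apply: eq_measure_integral => //= A mA AS; exact/lebesgue_measure_addr.
Qed.

(** By periodicity [z] may be replaced by its fractional part [w]. Translation by [w] carries [[0, 1
    - w[] onto [[w, 1[], and translation by [w - 1] carries [[1 - w, 1[] onto [[0, w[]. *)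
Lemma ge0_integral_periodic_addr (z : R) (f : R -> \bar R) :
  measurable_fun setT f -> (forall x, 0 <= f x)%E ->
  (forall (k : int) x, f (x + k%:~R) = f x) ->
  (\int[mu]_(x in `[0%R, 1%R[) f (x + z)%R = \int[mu]_(x in `[0%R, 1%R[) f x)%E.
Proof.
move=> mf f0 fp.
pose w := z - (Num.floor z)%:~R.
have -> : (fun x => f (x + z)) = (fun x => f (x + w)).
  by apply/funext => x; rewrite -[RHS](fp (Num.floor z)) /w; congr f; ring.
have [w0 w1] : 0 <= w /\ w < 1.
  have := ge_floor z; have := floorD1_gt z.
  by rewrite /w rmorphD/=; split; lra.
have pre (a b c : R) : (fun x : R => x + c) @^-1` `[a, b[ = `[a - c, b - c[%classic.
  by apply/seteqP; split => x /=; rewrite !in_itv/= lerBlDr ltrBrDr.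
have mfw c : measurable_fun setT (fun x : R => f (x + c)).
  by apply: measurableT_comp => //; apply: measurable_funD.
have split3 (a : R) (g : R -> \bar R) : 0 <= a <= 1 -> measurable_fun setT g ->
    (forall x, 0 <= g x)%E ->
    (\int[mu]_(x in `[0%R, 1%R[) g x =
     \int[mu]_(x in `[0%R, a[) g x + \int[mu]_(x in `[a, 1%R[) g x)%E.
  move=> /andP[a0 a1] mg g0.
  rewrite -ge0_integral_setU//=.
  - by rewrite -itv_bndbnd_setU// bnd_simp.
  - exact: measurable_funS mg.
  - by rewrite disj_set2E; apply/eqP/seteqP; split => // x [] /=;
      rewrite !in_itv/=; lra.
rewrite [LHS](split3 (1 - w) (fun x => f (x + w)))//; last by lra.
rewrite [RHS](split3 w)//; last by lra.
rewrite addeC; congr (_ + _)%E.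
- rewrite -(@ge0_integral_addr (w - 1) `[0, w[)//.
  have -> : (fun x => x + (w - 1)) @^-1` `[0, w[ = `[1 - w, 1[%classic.
    have e : w - (w - 1) = 1 by rewrite subKr.
    by rewrite pre e sub0r opprB.
  have fw (x : R) : f (x + (w - 1)) = f (x + w).
    by rewrite -(fp 1 (x + (w - 1))) -addrA subrK.
  by apply: eq_integral => x _; rewrite fw.
- rewrite -(@ge0_integral_addr w `[w, 1[)//.
  by rewrite pre subrr.
Qed.

End lebesgue_translation.

(** * Invariant measure on periodic sets *)

Section haar.
Context {R : realType}.

Definition cube d : set (d.-tuple R) := [set t | forall i, tnth t i \in `[0, 1[].

Lemma measurable_cube d : measurable (@cube d).
Proof.
by have := @measurable_tuple_box R d (fun=> [set` `[0, 1[]) (fun=> measurable_itv _).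
Qed.

(* On periodic sets this is the measure of the image in the torus R^d / Z^d. *)
Definition haar d : set (d.-tuple R) -> \bar R :=
  mrestr (lebesgue_tuple R d) (@measurable_cube d).

HB.instance Definition _ d := Measure.on (@haar d).

Lemma haar_box d (A : 'I_d -> set R) : (forall i, measurable (A i)) ->
  haar [set t | forall i, A i (tnth t i)] =
  (\prod_(i < d) lebesgue_measure (A i `&` `[0%R, 1%R[%classic))%E.
Proof.
move=> mA; rewrite -lebesgue_tuple_box; last by move=> i; exact: measurableI.
rewrite /haar /mrestr; congr (lebesgue_tuple _ _ _).
apply/seteqP; split => [t /= [At ct] i|t /= At]; first by split; [|exact: ct].
by split=> i; case: (At i).
Qed.

Lemma haar_setT d : @haar d setT = 1%E.
Proof.
rewrite (_ : setT = [set t : d.-tuple R | forall i, [set: R] (tnth t i)]).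
  rewrite (haar_box (A := fun=> setT))// big1// => i _.
  by rewrite setTI lebesgue_measure_itv/= lte_fin ltr01 oppr0 adde0.
by apply/seteqP; split.
Qed.

HB.instance Definition _ d :=
  Measure_isProbability.Build _ _ _ (@haar d) (@haar_setT d).

Definition shift d (z : 'I_d -> R) (t : d.-tuple R) : d.-tuple R :=
  [tuple tnth t i + z i | i < d].

(** One implication suffices for invariance, since [k] can be replaced by its opposite. *)
Definition periodic d (A : set (d.-tuple R)) :=
  forall (k : 'I_d -> int) t, A t -> A (shift (fun i => (k i)%:~R) t).

Lemma measurable_shift d (z : 'I_d -> R) : measurable_fun setT (shift z).
Proof.
apply/measurable_fun_tnthP => i.
rewrite (_ : _ \o _ = (fun t : d.-tuple R => tnth t i + z i)).
  by apply: measurable_funD => //; exact: measurable_tnth.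
by apply/funext => t /=; rewrite tnth_mktuple.
Qed.

Lemma measurable_preimage_shift d (z : 'I_d -> R) A :
  measurable A -> measurable (shift z @^-1` A).
Proof. by move=> mA; rewrite -[X in measurable X]setTI; exact: measurable_shift. Qed.

Lemma measurable_pair_cons d :
  measurable_fun setT (fun p : R * d.-tuple R => [tuple of p.1 :: p.2]).
Proof. exact: (@measurable_cons _ _ _ _ fst d snd). Qed.

Lemma haar_cons d (A : set (d.+1.-tuple R)) : measurable A ->
  haar A = (\int[lebesgue_measure]_(x in `[0%R, 1%R[)
    haar [set t : d.-tuple R | A [tuple of x :: t]])%E.
Proof.
move=> mA; rewrite {1}/haar /mrestr /= /pushforward /product_measure1.
rewrite [RHS]integral_mkcond; apply: eq_integral => x _ /=.
rewrite patchE; case: ifPn => [|] x01.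
  rewrite /haar /mrestr; congr (lebesgue_tuple _ _ _).
  apply/seteqP; split => t; rewrite /xsection/= inE/= => -[At ct].
    by split=> // i; have := ct (lift ord0 i); rewrite tnthS.
  split=> // i; case: (unliftP ord0 i) => [j ->|->].
    by rewrite tnthS; exact: ct.
  by rewrite inE in x01.
rewrite (_ : xsection _ _ = set0) ?measure0//.
apply/seteqP; split => // t; rewrite /xsection/= inE/= => -[_ /(_ ord0)].
by move=> h; case/negP: x01; rewrite inE.
Qed.

Lemma measurable_haar_section d (A : set (d.+1.-tuple R)) : measurable A ->
  measurable_fun setT (fun x : R => haar [set t : d.-tuple R | A [tuple of x :: t]]).
Proof.
move=> mA.
pose B := (fun p : R * d.-tuple R => [tuple of p.1 :: p.2]) @^-1` A.
have mB : measurable B.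
  by rewrite -[B]setTI; apply: (@measurable_pair_cons d).
rewrite (_ : (fun _ => _) = @haar d \o xsection B).
  exact: measurable_fun_xsection.
apply/funext => x /=; congr haar; apply/seteqP; split => t;
  by rewrite /xsection/= inE.
Qed.

(** Induction on the dimension, slicing along the first coordinate: the induction hypothesis absorbs
    the shift inside each slice, and the measure [h] of the slice is a function of period 1, whose
    integral ignores the remaining shift. *)
Lemma haar_shift d (z : 'I_d -> R) (A : set (d.-tuple R)) :
  measurable A -> periodic A -> haar (shift z @^-1` A) = haar A.
Proof.
elim: d z A => [|d IH] z A mA pA.
  by congr haar; apply/seteqP; split => t /=; rewrite (tuple0 t) (tuple0 (shift _ _)).
have shiftE (w : 'I_d.+1 -> R) (x : R) (t : d.-tuple R) :
    shift w [tuple of x :: t] =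
    [tuple of x + w ord0 :: shift (fun i => w (lift ord0 i)) t].
  apply/eq_from_tnth => i; rewrite tnth_mktuple.
  by case: (unliftP ord0 i) => [j ->|->]; rewrite ?tnthS ?tnth_mktuple.
pose h (x : R) := haar [set t : d.-tuple R | A [tuple of x :: t]].
have mS x : measurable [set t : d.-tuple R | A [tuple of x :: t]].
  have mB := @measurable_pair_cons d measurableT _ mA.
  rewrite setTI in mB.
  rewrite (_ : [set t | _] = xsection ((fun p : R * d.-tuple R =>
    [tuple of p.1 :: p.2]) @^-1` A) x); first exact: measurable_xsection.
  by apply/seteqP; split => t; rewrite /xsection/= inE.
rewrite haar_cons; last exact: measurable_preimage_shift.
rewrite haar_cons// -[RHS](@ge0_integral_periodic_addr _ (z ord0) h)//.
- apply: eq_integral => x _; rewrite /h -[RHS](IH (fun i => z (lift ord0 i))).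
  + by congr haar; apply/seteqP; split => t /=; rewrite shiftE.
  + exact: mS.
  + move=> k t /= At.
    (* Slices inherit periodicity from integer vectors with first coordinate 0. *)
    have := pA (fun i => if unlift ord0 i is Some j then k j else 0) _ At.
    rewrite shiftE unlift_none addr0.
    rewrite (_ : shift _ t = shift (fun i => (k i)%:~R) t)//.
    by congr shift; apply/funext => i; rewrite liftK.
- exact: measurable_haar_section.
- move=> k x; rewrite /h; congr haar.
  have inv : forall (j : int) (y : R) (t : d.-tuple R), A [tuple of y :: t] ->
      A [tuple of y + j%:~R :: t].
    move=> j y t /(pA (fun i => if unlift ord0 i is Some _ then 0 else j)).
    rewrite shiftE unlift_none (_ : shift _ t = t)//.
    by apply/eq_from_tnth => i; rewrite tnth_mktuple liftK addr0.
  apply/seteqP; split => t /= At; last exact: inv.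
  by rewrite -(addrK k%:~R x) -mulrNz; exact: inv.
Qed.

End haar.

(** * Averaging over translations *)

Lemma shift_tnthC {R : realType} d (s t : d.-tuple R) :
  shift (tnth s) t = shift (tnth t) s.
Proof. by apply/eq_from_tnth => i; rewrite !tnth_mktuple addrC. Qed.

Section averaging.
Context {R : realType} (d e : nat) (L : d.-tuple R -> e.-tuple R).
Hypothesis mL : measurable_fun setT L.

Let graph (A : set (d.-tuple R)) (B : set (e.-tuple R)) :=
  [set p : d.-tuple R * e.-tuple R | A p.1 /\ B (shift (tnth p.2) (L p.1))].

Let measurable_graph A B : measurable A -> measurable B -> measurable (graph A B).
Proof.
move=> mA mB; apply: measurableI.
  by rewrite -[X in measurable X]setTI; exact: measurable_fst.
have mf : measurable_fun setT
    (fun p : d.-tuple R * e.-tuple R => shift (tnth p.2) (L p.1)).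
  apply/measurable_fun_tnthP => i.
  rewrite (_ : _ \o _ = (fun p : d.-tuple R * e.-tuple R =>
    tnth (L p.1) i + tnth p.2 i)); last first.
    by apply/funext => p /=; rewrite tnth_mktuple.
  apply: measurable_funD.
    apply: (measurableT_comp (measurable_tnth i)).
    exact: (measurableT_comp mL).
  by apply: (measurableT_comp (measurable_tnth i)).
by rewrite -[X in measurable X]setTI; exact: mf.
Qed.

Let haar_ysection A B : (fun z => haar [set X | A X /\ B (shift (tnth z) (L X))]) =
  haar (d := d) \o ysection (graph A B).
Proof.
apply/funext => z /=; congr haar.
by apply/seteqP; split => X; rewrite /ysection/= inE.
Qed.

Let measurable_haar_ysection A B : measurable A -> measurable B ->
  measurable_fun setT (fun z => haar [set X | A X /\ B (shift (tnth z) (L X))]).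
Proof.
move=> mA mB; rewrite haar_ysection; apply: measurable_fun_ysection.
exact: measurable_graph.
Qed.

(* Averaging over all translations turns the pair (X, L X) into an independent pair. *)
Lemma haar_average (A : set (d.-tuple R)) (B : set (e.-tuple R)) :
  measurable A -> measurable B -> periodic B ->
  (\int[haar (d := e)]_z haar [set X | A X /\ B (shift (tnth z) (L X))] =
   haar A * haar B)%E.
Proof.
move=> mA mB pB; have mS := measurable_graph mA mB.
have := indic_fubini_tonelli (haar (d := d)) (haar (d := e)) mS.
rewrite indic_fubini_tonelli_FE// indic_fubini_tonelli_GE// => E.
rewrite haar_ysection -E.
(* After exchanging the integrals: for [X] in [A] the admissible [z] form a translate of [B], of the
   same measure as [B]; for other [X] there are none. *)
transitivity (\int[haar (d := d)]_X (haar B * (\1_A X)%:E))%E.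
  apply: eq_integral => X _ /=; rewrite indicE.
  have [AX|AX] := boolP (X \in A); rewrite ?mule1 ?mule0.
    rewrite -(@haar_shift _ _ (tnth (L X)) B)//; congr haar.
    apply/seteqP; split => z; rewrite /xsection/= inE/=.
      by move=> [_]; rewrite shift_tnthC.
    by rewrite inE in AX => Bz; split=> //; rewrite shift_tnthC.
  rewrite (_ : xsection _ _ = set0) ?measure0//.
  apply/seteqP; split => // z; rewrite /xsection/= inE/= => -[/mem_set h].
  by rewrite h in AX.
rewrite ge0_integralZl//; first by rewrite integral_indic// setIT muleC.
by apply/measurable_EFinP.
Qed.

(** For each [z] the translation by [w] preserves the measure of the left-hand set and carries its
    preimage into the set integrated in [haar_average]; integrating over [z], of total mass 1, gives
    the bound. [B'] is [B] enlarged by the error with which [w] realises [z]. *)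
Lemma haar_transport_le (A : set (d.-tuple R)) (B B' : set (e.-tuple R)) :
  measurable A -> measurable B -> measurable B' -> periodic B' ->
  periodic (A `&` L @^-1` B) ->
  (forall z : 'I_e -> R, exists w : 'I_d -> R, forall X, A (shift w X) ->
    B (L (shift w X)) -> A X /\ B' (shift z (L X))) ->
  (haar (A `&` L @^-1` B) <= haar A * haar B')%E.
Proof.
move=> mA mB mB' pB' pAB zw; rewrite -haar_average//.
have mAB : measurable (A `&` L @^-1` B).
  by apply: measurableI => //; rewrite -[X in measurable X]setTI; exact: mL.
have mS z : measurable [set X | A X /\ B' (shift z (L X))].
  apply: measurableI => //; rewrite -[X in measurable X]setTI.
  by apply: (measurableT_comp (@measurable_shift R e z) mL).
rewrite -[leLHS]mule1 -(@haar_setT R e) -integral_cst//.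
apply: ge0_le_integral => //.
- exact: measurable_haar_ysection.
- move=> z _; have [w hw] := zw (tnth z).
  rewrite -(@haar_shift _ _ w)//; apply: le_measure; rewrite ?inE//.
    exact: measurable_preimage_shift.
  by move=> X [] /hw + /= => /[apply].
Qed.

(** The same averaging with the inclusions reversed. *)
Lemma haar_transport_ge (A : set (d.-tuple R)) (B B' : set (e.-tuple R)) :
  measurable A -> measurable B -> measurable B' -> periodic B ->
  periodic (A `&` L @^-1` B') ->
  (forall z : 'I_e -> R, exists w : 'I_d -> R, forall X, A X ->
    B (shift z (L X)) -> A (shift w X) /\ B' (L (shift w X))) ->
  (haar A * haar B <= haar (A `&` L @^-1` B'))%E.
Proof.
move=> mA mB mB' pB pAB zw; rewrite -haar_average//.
have mAB : measurable (A `&` L @^-1` B').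
  by apply: measurableI => //; rewrite -[X in measurable X]setTI; exact: mL.
have mS z : measurable [set X | A X /\ B (shift z (L X))].
  apply: measurableI => //; rewrite -[X in measurable X]setTI.
  by apply: (measurableT_comp (@measurable_shift R e z) mL).
rewrite -[leRHS]mule1 -(@haar_setT R e) -integral_cst//.
apply: ge0_le_integral => //.
- exact: measurable_haar_ysection.
- move=> z _; have [w hw] := zw (tnth z).
  rewrite -[leRHS](@haar_shift _ _ w)//; apply: le_measure; rewrite ?inE//.
    exact: measurable_preimage_shift.
  by move=> X [] /hw + /= => /[apply].
Qed.

End averaging.

(** * Systems of linear forms *)

Section near_coset.
Context {R : realType}.
Local Notation mu := (@lebesgue_measure R).

Definition near_coset (c delta : R) : set R :=
  [set x | exists p : int, `|x - c - p%:~R| < delta].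

(** Every error made in realising a translation is converted here into a change of radius. *)
Lemma near_shift c delta r (k : int) x x' :
  `|x' - x - k%:~R| <= r -> near_coset c delta x -> near_coset c (delta + r) x'.
Proof.
move=> xx' [p xp]; exists (p + k).
rewrite rmorphD/=.
have -> : x' - c - (p%:~R + k%:~R) = (x - c - p%:~R) + (x' - x - k%:~R) by ring.
by rewrite (le_lt_trans (ler_normD _ _))// ltr_leD.
Qed.

Lemma near_addz c delta x (k : int) : near_coset c delta (x + k%:~R) = near_coset c delta x.
Proof.
apply/propext; split => h; rewrite -(addr0 delta).
  apply: (@near_shift _ _ _ (- k) _ _ _ h).
  have -> : x - (x + k%:~R) - (- k)%:~R = 0 by rewrite rmorphN/=; ring.
  by rewrite normr0.
apply: (@near_shift _ _ _ k _ _ _ h).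
have -> : x + k%:~R - x - k%:~R = 0 by ring.
by rewrite normr0.
Qed.

Lemma near_le c d1 d2 x : d1 <= d2 -> near_coset c d1 x -> near_coset c d2 x.
Proof. by move=> d12 [p xp]; exists p; exact: lt_le_trans d12. Qed.

Lemma near_open c delta x : near_coset c delta x ->
  exists2 r, 0 < r & near_coset c (delta - r) x.
Proof.
move=> [p xp]; exists ((delta - `|x - c - p%:~R|) / 2); first lra.
by exists p; lra.
Qed.

Lemma measurable_near c delta : measurable (near_coset c delta).
Proof.
rewrite (_ : near_coset _ _ =
    \bigcup_(p : int) `]c + p%:~R - delta, c + p%:~R + delta[%classic).
  apply: countable_bigcupT_measurable => [|p]; first exact: countableP.
  exact: measurable_itv.
apply/seteqP; split => x /=.
  by move=> [p]; rewrite ltr_norml => xp; exists p => //=; rewrite in_itv/=; lra.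
by move=> [p _]; rewrite /= in_itv/= => xp; exists p; rewrite ltr_norml; lra.
Qed.

(** Around the centre [1/2] the neighbourhood does not wrap around the unit interval, so only
    [p = 0] contributes. *)
Let near_half delta : delta <= 1/2 ->
  near_coset (1/2) delta `&` `[0%R, 1%R[ = `]1/2 - delta, 1/2 + delta[%classic.
Proof.
move=> d2; apply/seteqP; split => x /=.
  rewrite !in_itv/= => -[[p]]; rewrite ltr_norml => xp x01.
  suff p0 : p = 0 by rewrite p0 in xp; lra.
  have p1 : (p%:~R : R) < 1%:~R by lra.
  have p2 : ((-1)%:~R : R) < p%:~R by rewrite rmorphN/=; lra.
  by rewrite !ltr_int in p1 p2; lia.
rewrite !in_itv/= => x01; split; last by lra.
by exists 0; rewrite ltr_norml; lra.
Qed.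

Let near_center c delta :
  mu (near_coset c delta `&` `[0%R, 1%R[%classic) =
  mu (near_coset (1/2) delta `&` `[0%R, 1%R[%classic).
Proof.
have mN := measurable_near (1/2) delta.
rewrite -[RHS]integral_indic// -[LHS]integral_indic//; last exact: measurable_near.
rewrite -[RHS](@ge0_integral_periodic_addr R (1/2 - c)
  (fun x => (\1_(near_coset (1/2) delta) x)%:E)).
- apply: eq_integral => x _; congr (_%:E); rewrite !indicE; congr (_%:R).
  have e : x + (1/2 - c) - 1/2 = x - c by lra.
  by congr nat_of_bool; apply/idP/idP; rewrite !inE /near_coset/= e.
- exact/measurable_EFinP.
- by [].
- move=> k x; congr (_%:E); rewrite !indicE; congr (_%:R); congr nat_of_bool.
  by apply/idP/idP; rewrite !inE near_addz.
Qed.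

Lemma lebesgue_near c delta : 0 <= delta <= 1/2 ->
  mu (near_coset c delta `&` `[0%R, 1%R[%classic) = (2 * delta)%:E.
Proof.
move=> /andP[d0 d2]; rewrite near_center near_half// lebesgue_measure_itv/= lte_fin.
case: ltP => h; first by rewrite -EFinD; congr (_%:E); lra.
by congr (_%:E); lra.
Qed.

End near_coset.

Section near_box.
Context {R : realType} (m : nat) (y : 'rV[R]_m).

Definition near_box (delta : R) : set (m.-tuple R) :=
  [set t | forall j, near_coset (y 0 j) delta (tnth t j)].

Lemma measurable_near_box delta : measurable (near_box delta).
Proof.
apply: (@measurable_tuple_box R m (fun j => near_coset (y 0 j) delta)) => j.
exact: measurable_near.
Qed.

Lemma near_box_shiftz delta (k : 'I_m -> int) t :
  near_box delta (shift (fun i => (k i)%:~R) t) = near_box delta t.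
Proof.
apply/propext; split => h j; have := h j;
  by rewrite tnth_mktuple near_addz.
Qed.

Lemma periodic_near_box delta : periodic (near_box delta).
Proof. by move=> k t; rewrite near_box_shiftz. Qed.

Lemma haar_near_box delta : 0 <= delta <= 1/2 ->
  haar (near_box delta) = ((2 * delta) ^+ m)%:E.
Proof.
move=> d01; rewrite (haar_box (A := fun j => near_coset (y 0 j) delta)).
  under eq_bigr do rewrite lebesgue_near//.
  by rewrite prodEFin prodr_const card_ord.
by move=> j; exact: measurable_near.
Qed.

Lemma haar_near_box_le delta : 0 <= delta ->
  (haar (near_box delta) <= ((2 * delta) ^+ m)%:E)%E.
Proof.
move=> d0; have [d2|d2] := lerP delta (1/2); first by rewrite haar_near_box// d0.
rewrite (le_trans (probability_le1 _ (measurable_near_box _)))// lee_fin.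
by rewrite exprn_ege1//; lra.
Qed.

End near_box.

(** * Proportional integer vectors *)

Section integer_vectors.
Context {n : nat}.
Implicit Types q : 'rV[int]_n.

Lemma row_neq0 q : q != 0 -> exists i, q 0 i != 0.
Proof.
move=> q0; apply/existsP; apply: contraNT q0 => /existsPn h.
by apply/eqP/rowP => i; rewrite mxE; apply/eqP; rewrite -[_ == _]negbK.
Qed.

(** If all minors through a nonzero entry [q_i] vanish, dividing [q_i] and [q'_i] by their gcd gives
    the ratio in lowest terms. The entry bounds confine the denominators arising from finitely many
    vectors to a finite range. *)
Lemma row_dependent q q' : q != 0 -> q' != 0 ->
  (exists i k, q 0 i * q' 0 k - q 0 k * q' 0 i != 0) \/
  exists a b : int, [/\ 0 < a, b != 0, coprimez a b, a *: q' = b *: q &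
    exists i, a <= `|q 0 i| /\ `|b| <= `|q' 0 i|].
Proof.
move=> q0 q'0; have [i qi0] := row_neq0 q0.
have [[k hk]|hk] := pselect (exists k, q 0 i * q' 0 k - q 0 k * q' 0 i != 0).
  by left; exists i, k.
right; have {}hk k : q 0 i * q' 0 k = q 0 k * q' 0 i.
  by apply/eqP; rewrite -subr_eq0; apply: contraPT (erefl true) => h;
     case: hk; exists k.
have q'i0 : q' 0 i != 0.
  apply: contra_neqN q'0 => /eqP h; apply/rowP => k; rewrite mxE.
  by have /eqP := hk k; rewrite h mulr0 mulf_eq0 (negbTE qi0) => /eqP.
pose g := gcdz (q 0 i) (q' 0 i).
have g0 : g != 0 by rewrite gcdz_eq0 negb_and qi0.
have gpos : 0 < g by rewrite lt_neqAle eq_sym g0.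
(* The sign of [q_i] is moved to the numerator [b], which makes [a] positive. *)
pose s := Num.sg (q 0 i).
have s0 : s != 0 by rewrite sgr_eq0.
have [a0 ea0] : exists a0, q 0 i = a0 * g by apply/dvdzP; exact: dvdz_gcdl.
have [b0 eb0] : exists b0, q' 0 i = b0 * g by apply/dvdzP; exact: dvdz_gcdr.
have sa : s = Num.sg a0 by rewrite /s ea0 sgrM (gtr0_sg gpos) mulr1.
have a00 : a0 != 0 by apply: contra_neq qi0 => h; rewrite ea0 h mul0r.
have b00 : b0 != 0 by apply: contra_neq q'i0 => h; rewrite eb0 h mul0r.
have cop : coprimez a0 b0.
  have [u [v uv]] := Bezoutz (q 0 i) (q' 0 i).
  apply/coprimezP; exists (u, v) => /=; apply: (mulIf g0).
  by rewrite mul1r mulrDl -!mulrA -ea0 -eb0.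
exists `|a0|, (s * b0); split.
- by rewrite normr_gt0.
- by rewrite mulf_neq0.
- move: cop; rewrite !coprimezE abszM sa absz_sg a00 mul1n.
  by rewrite (_ : absz (Num.norm a0) = absz a0)//; lia.
- apply/rowP => k; rewrite !mxE -[`|a0|]mulr1.
  have := hk k; rewrite ea0 eb0 => h.
  have {}h : a0 * q' 0 k = b0 * q 0 k by apply: (mulIf g0); lia.
  by rewrite mulr1 normrEsg -sa -!mulrA h.
- exists i; split; first by rewrite ea0 normrM (gtr0_norm gpos) ler_peMr//; lia.
  by rewrite eb0 !normrM (gtr0_norm gpos) sa normr_sg a00 mul1r ler_peMr//; lia.
Qed.

End integer_vectors.

(** * Translations of [X] and of [q X] *)

Section linear_forms.
Context {R : realType} {n m : nat}.
Implicit Types (q : 'rV[int]_n) (Z : 'M[R]_(n, m)).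
Local Notation "q ^R" := (map_mx intr q : 'rV[R]_n) (at level 2, format "q ^R").

Definition linear_forms q (t : (n * m).-tuple R) : m.-tuple R :=
  [tuple (q^R *m mx_of_tuple t) 0 j | j < m].

Definition mx_shift Z : (n * m).-tuple R -> (n * m).-tuple R :=
  shift (fun i => mxvec Z 0 i).

Lemma mx_of_tuple_shift Z t : mx_of_tuple (mx_shift Z t) = mx_of_tuple t + Z.
Proof.
by apply/matrixP => i j; rewrite !mxE tnth_mktuple mxvecE.
Qed.

Lemma shift_mxE (z : 'I_(n * m) -> R) : shift z = mx_shift (vec_mx (\row_i z i)).
Proof.
by rewrite /mx_shift vec_mxK; congr shift; apply/funext => i; rewrite mxE.
Qed.

Lemma linear_forms_shift q Z t :
  linear_forms q (mx_shift Z t) = shift (fun j => (q^R *m Z) 0 j) (linear_forms q t).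
Proof.
apply/eq_from_tnth => j; rewrite !tnth_mktuple mx_of_tuple_shift mulmxDr.
by rewrite [LHS]mxE.
Qed.

Lemma measurable_linear_forms q : measurable_fun setT (linear_forms q).
Proof.
apply/measurable_fun_tnthP => j.
rewrite (_ : _ \o _ = (fun t : (n * m).-tuple R =>
    \sum_i (q 0 i)%:~R * tnth t (mxvec_index i j))); last first.
  apply/funext => t /=; rewrite tnth_mktuple mxE.
  by apply: eq_bigr => i _; rewrite !mxE.
apply: measurable_sum => i; apply: measurable_funM => //.
exact: measurable_tnth.
Qed.

Lemma linear_forms_shiftz q (k : 'I_(n * m) -> int) : exists l : 'I_m -> int,
  forall t, linear_forms q (shift (fun i => (k i)%:~R) t) =
            shift (fun j => (l j)%:~R) (linear_forms q t).
Proof.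
exists (fun j => (q *m vec_mx (\row_i k i)) 0 j) => t.
rewrite shift_mxE linear_forms_shift; congr shift; apply/funext => j.
rewrite !mxE rmorph_sum; apply: eq_bigr => i _.
by rewrite !mxE rmorphM.
Qed.

Lemma periodic_linear_forms q B : periodic B -> periodic (linear_forms q @^-1` B).
Proof.
move=> pB k t /= Bt; have [l ->] := linear_forms_shiftz q k.
exact: pB.
Qed.

Lemma linear_forms_surj q (r : 'rV[R]_m) : q != 0 -> exists Z, q^R *m Z = r.
Proof.
move=> /row_neq0[i qi0]; have qi : (q 0 i)%:~R != 0 :> R by rewrite intr_eq0.
exists (((q 0 i)%:~R^-1 *: delta_mx i 0) *m r).
rewrite mulmxA -scalemxAr -colE (_ : _ *: _ = 1%:M) ?mul1mx//.
by apply/rowP => k; rewrite !mxE mulVf// [k]ord1 eqxx.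
Qed.

(** The column [q_i e_k - q_k e_i] is annihilated by [q] and paired with [q'] gives the minor [D];
    divide it by [D] and multiply by the row [r]. *)
Lemma linear_forms_surj2 q q' i k (r : 'rV[R]_m) :
  q 0 i * q' 0 k - q 0 k * q' 0 i != 0 ->
  exists2 Z, q^R *m Z = 0 & q'^R *m Z = r.
Proof.
move=> D0.
set D := _ - _ in D0; have DR : D%:~R != 0 :> R by rewrite intr_eq0.
exists ((D%:~R^-1 *: ((q 0 i)%:~R *: delta_mx k 0 - (q 0 k)%:~R *: delta_mx i 0)) *m r).
  rewrite mulmxA -scalemxAr mulmxBr -!scalemxAr -!colE (_ : _ - _ = 0).
    by rewrite scaler0 mul0mx.
  by apply/rowP => l; rewrite !mxE; ring.
rewrite mulmxA -scalemxAr mulmxBr -!scalemxAr -!colE (_ : _ *: _ = 1%:M) ?mul1mx//.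
apply/rowP => l; rewrite !mxE [l]ord1 eqxx -!rmorphM -rmorphB/=.
by rewrite -/D mulVf.
Qed.

End linear_forms.

Lemma row_funK (T : Type) m (z : 'I_m -> T) : (fun j => (\row_j z j) 0 j) = z.
Proof. by apply/funext => j; rewrite mxE. Qed.

(** * Measures of the approximation sets and of their intersections *)

Section approximation.
Context {R : realType} {n m : nat} (y : 'rV[R]_m).
Implicit Types (q : 'rV[int]_n).
Local Notation "q ^R" := (map_mx intr q : 'rV[R]_n) (at level 2, format "q ^R").

Definition approx q (delta : R) : set ((n * m).-tuple R) :=
  linear_forms q @^-1` near_box y delta.

Lemma measurable_approx q delta : measurable (approx q delta).
Proof.
rewrite -[X in measurable X]setTI.
by apply: measurable_linear_forms => //; exact: measurable_near_box.
Qed.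

Lemma periodic_approx q delta : periodic (approx q delta).
Proof. by apply: periodic_linear_forms; exact: periodic_near_box. Qed.

Lemma periodicI d (A B : set (d.-tuple R)) :
  periodic A -> periodic B -> periodic (A `&` B).
Proof. by move=> pA pB k t [At Bt]; split; [exact: pA|exact: pB]. Qed.

Lemma periodicT d : periodic [set: d.-tuple R].
Proof. by move=> k t. Qed.

(** Every translation of [q X] is realised exactly, so the transport applies to the whole space
    without enlarging the box. *)
Lemma haar_approx_le q delta : q != 0 -> 0 <= delta ->
  (haar (approx q delta) <= ((2 * delta) ^+ m)%:E)%E.
Proof.
move=> q0 d0; rewrite -[approx _ _]setTI.
apply: (@le_trans _ _ (haar [set: (n * m).-tuple R] * haar (near_box y delta)))%E.
  apply: haar_transport_le => //.
  - exact: measurable_linear_forms.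
  - exact: measurable_near_box.
  - exact: measurable_near_box.
  - exact: periodic_near_box.
  - by apply: periodicI; [exact: periodicT|exact: periodic_approx].
  move=> z; have [Z qZ] := @linear_forms_surj R n m q (\row_j z j) q0.
  exists (fun i => mxvec Z 0 i) => X _; by rewrite linear_forms_shift qZ row_funK.
by rewrite haar_setT mul1e haar_near_box_le.
Qed.

Lemma haar_approx q delta : q != 0 -> 0 <= delta <= 1/2 ->
  haar (approx q delta) = ((2 * delta) ^+ m)%:E.
Proof.
move=> q0 d0; apply/eqP; rewrite eq_le haar_approx_le//=; last by case/andP: d0.
rewrite -(haar_near_box y d0) -[leLHS]mul1e -(@haar_setT R (n * m)) -[approx _ _]setTI.
apply: haar_transport_ge => //.
- exact: measurable_linear_forms.
- exact: measurable_near_box.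
- exact: measurable_near_box.
- exact: periodic_near_box.
- by apply: periodicI; [exact: periodicT|exact: periodic_approx].
move=> z; have [Z qZ] := @linear_forms_surj R n m q (\row_j z j) q0.
exists (fun i => mxvec Z 0 i) => X _; by rewrite linear_forms_shift qZ row_funK.
Qed.

(** The translations [Z] with [q Z = 0] preserve [approx q d] and still move [q' X] arbitrarily, so
    no radius is lost. *)
Lemma haar_approxI_indep q q' i k d d' : 0 <= d' ->
  q 0 i * q' 0 k - q 0 k * q' 0 i != 0 ->
  (haar (approx q d `&` approx q' d') <=
   haar (approx q d) * ((2 * d') ^+ m)%:E)%E.
Proof.
move=> d'0 D0; apply: (@le_trans _ _ (haar (approx q d) * haar (near_box y d')))%E.
  apply: haar_transport_le => //.
  - exact: measurable_linear_forms.
  - exact: measurable_approx.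
  - exact: measurable_near_box.
  - exact: measurable_near_box.
  - exact: periodic_near_box.
  - by apply: periodicI; exact: periodic_approx.
  move=> z; have [Z qZ q'Z] := @linear_forms_surj2 R n m q q' i k (\row_j z j) D0.
  exists (fun i => mxvec Z 0 i) => X.
  rewrite /approx/= !linear_forms_shift qZ q'Z row_funK.
  rewrite (_ : shift _ (linear_forms q X) = linear_forms q X)//.
  by apply/eq_from_tnth => j; rewrite tnth_mktuple mxE addr0.
by rewrite lee_wpmul2l// haar_near_box_le.
Qed.

(* The translations preserving [approx q d] move [q' X] through the points of
   [(1 / a) Z^m], modulo [Z^m]; hence the loss of [1 / a] in the radius. *)
Lemma haar_approxI_dep q q' (a b : int) d d' : q != 0 -> 0 <= d' ->
  0 < a -> coprimez a b -> a *: q' = b *: q ->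
  (haar (approx q d `&` approx q' d') <=
   haar (approx q d) * ((2 * (d' + a%:~R^-1)) ^+ m)%:E)%E.
Proof.
move=> q0 d'0 a0 /coprimezP[[u v] /= uv] qq'.
have aR : 0 < a%:~R :> R by rewrite ltr0z.
have bq : q'^R = (b%:~R / a%:~R) *: q^R.
  apply/rowP => l; rewrite !mxE; have /rowP/(_ l) := qq'; rewrite !mxE => e.
  have {}e : a%:~R * (q' 0 l)%:~R = b%:~R * (q 0 l)%:~R :> R by rewrite -!intrM e.
  by apply: (mulfI (lt0r_neq0 aR)); rewrite e; field; rewrite lt0r_neq0.
apply: (@le_trans _ _ (haar (approx q d) * haar (near_box y (d' + a%:~R^-1))))%E.
  apply: haar_transport_le => //.
  - exact: measurable_linear_forms.
  - exact: measurable_approx.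
  - exact: measurable_near_box.
  - exact: measurable_near_box.
  - exact: periodic_near_box.
  - by apply: periodicI; exact: periodic_approx.
  move=> z; pose f j := Num.floor (a%:~R * z j).
  (* As [q Z = v f] is integral, [approx q d] is preserved. With [u a + v b = 1],
     [q' Z = (b / a) v f = f / a - u f], which modulo integers is [f / a], within [1 / a] of [z]. *)
  have [Z qZ] := @linear_forms_surj R n m q (\row_j (v * f j)%:~R) q0.
  exists (fun i => mxvec Z 0 i) => X; rewrite /approx/= !linear_forms_shift.
  rewrite bq -scalemxAl qZ.
  rewrite row_funK near_box_shiftz => hq hq'; split=> // j.
  have := hq' j; rewrite !tnth_mktuple.
  apply: (@near_shift _ _ _ _ (u * f j)); rewrite !mxE.
  set t := (\sum_ _ _ ).
  have uvR : u%:~R * a%:~R + v%:~R * b%:~R = 1 :> R by rewrite -!intrM -intrD uv.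
  rewrite (_ : _ - _ - _ = (a%:~R * z j - (f j)%:~R) / a%:~R); last first.
    rewrite !intrM; apply: (mulIf (lt0r_neq0 aR)).
    rewrite divfK ?lt0r_neq0//.
    transitivity (a%:~R * z j - (u%:~R * a%:~R + v%:~R * b%:~R) * (f j)%:~R).
      by field; exact: lt0r_neq0.
    by rewrite uvR mul1r.
  have := ge_floor (a%:~R * z j); have := floorD1_gt (a%:~R * z j).
  rewrite -/(f j) rmorphD/= => h1 h2.
  rewrite normrM normfV (gtr0_norm aR) ler_piMl ?invr_ge0 ?ltW//.
  by rewrite ger0_norm; lra.
rewrite lee_wpmul2l// haar_near_box_le// addr_ge0// invr_ge0 ltW//.
Qed.

End approximation.

(** * The second moment *)

Lemma ler_sum_seq1 (R : numDomainType) (I : eqType) (s : seq I) i (F : I -> R) :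
  i \in s -> (forall j, 0 <= F j) -> F i <= \sum_(j <- s) F j.
Proof.
by move=> si F0; rewrite (big_rem i)//= lerDl; apply: sumr_ge0.
Qed.

Lemma sum_unique_le1 (R : numDomainType) (I : eqType) (s : seq I) (P : pred I) :
  uniq s -> (forall i j, P i -> P j -> i = j) -> \sum_(i <- s) (P i)%:R <= 1 :> R.
Proof.
move=> us Pij; rewrite -natr_sum (_ : (\sum_(i <- s) _)%N = count P s); last first.
  by rewrite -sum1_count [RHS]big_mkcond; apply: eq_bigr => i _; case: (P i).
rewrite (ler_nat _ _ 1) -size_filter.
case E : [seq i <- s | P i] => [//|i r].
apply: (@uniq_leq_size _ (i :: r) [:: i]); first by rewrite -E filter_uniq.
have Pi : P i by have := mem_head i r; rewrite -E mem_filter => /andP[].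
move=> j; rewrite -E mem_filter inE => /andP[Pj _].
by rewrite (Pij j i).
Qed.

Lemma sum_inv_sqr_le2 (R : realFieldType) K :
  \sum_(1 <= k < K.+1) (k%:R ^+ 2)^-1 <= 2 :> R.
Proof.
case: K => [|K]; first by rewrite big_geq//; lra.
(* The induction needs this sharper bound; its step then reduces to the positivity of
   [1 / (x (x + 1)^2)]. *)
apply: (@le_trans _ _ (2 - K.+1%:R^-1)); last by rewrite gerBl invr_ge0 ler0n.
elim: K => [|K IH]; first by rewrite big_nat1 invr1; lra.
rewrite big_nat_recr//=; apply: (le_trans (lerD IH (lexx _))).
have x0 : 0 < K.+1%:R :> R by rewrite ltr0n.
rewrite [in leLHS]mulrSr [in leRHS]mulrSr; set x : R := K.+1%:R in x0 *.
rewrite -addrA lerD2l addrC -subr_ge0.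
rewrite (_ : _ - _ = (x * (x + 1) ^+ 2)^-1); last by field; rewrite !gt_eqF//; lra.
by rewrite invr_ge0 mulr_ge0 ?exprn_ge0//; lra.
Qed.

(** [2 (x + z)] is at most four times the larger of [2 x] and [z]. *)
Lemma exprDn_le4 (R : realFieldType) (x z : R) m : 0 <= x -> 0 <= z ->
  (2 * (x + z)) ^+ m <= 4 ^+ m * ((2 * x) ^+ m + z ^+ m).
Proof.
move=> x0 z0.
have [xz|zx] := leP (2 * x) z.
  rewrite (@le_trans _ _ ((4 * z) ^+ m))//.
    by apply: lerXn2r; rewrite ?nnegrE; lra.
  by rewrite exprMn ler_wpM2l ?exprn_ge0// ler_wpDl// exprn_ge0//; lra.
rewrite (@le_trans _ _ ((4 * (2 * x)) ^+ m))//.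
  by apply: lerXn2r; rewrite ?nnegrE; lra.
by rewrite [leLHS]exprMn ler_wpM2l ?exprn_ge0// ler_wpDr// exprn_ge0//; lra.
Qed.

Section pair_weight.
Context {R : realType} {n : nat} (m : nat).
Implicit Types (q : 'rV[int]_n) (G : seq 'rV[int]_n).

(* Each [q'] with [k q' = c q] and [|c| <= k] has weight [k^-m]: this is the part of
   the overlap of a proportional pair that exceeds the product of the measures. *)
Definition pair_weight (K : nat) q q' : R :=
  \sum_(1 <= k < K.+1) \sum_(0 <= b < (2 * k).+1)
    (k%:Z *: q' == (b%:Z - k%:Z) *: q)%:R / k%:R ^+ m.

Lemma pair_weight_ge0 K q q' : 0 <= pair_weight K q q'.
Proof.
apply: sumr_ge0 => k _; apply: sumr_ge0 => b _.
by rewrite divr_ge0// exprn_ge0.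
Qed.

Lemma pair_weight_ge K (a b : int) q q' : 0 < a -> `|b| <= a -> a <= K%:Z ->
  a *: q' = b *: q -> (a%:~R ^+ m)^-1 <= pair_weight K q q'.
Proof.
case: a => [k|//] k0 bk kK e.
have term_ge0 (k' b' : nat) :
    0 <= (k'%:Z *: q' == (b'%:Z - k'%:Z) *: q)%:R / k'%:R ^+ m :> R.
  by rewrite divr_ge0// exprn_ge0.
have k1 : (k \in index_iota 1 K.+1) by rewrite mem_index_iota; lia.
(* The summation index ranges over [[0, 2 k]] and stands for a numerator in [[-k, k]], hence the
   offset [k]. *)
pose c := absz (b + k%:Z).
have c1 : (c \in index_iota 0 (2 * k).+1) by rewrite mem_index_iota; lia.
apply: le_trans (ler_sum_seq1 k1 _); last by move=> k'; apply: sumr_ge0.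
apply: le_trans (ler_sum_seq1 c1 _); last by [].
have -> : c%:Z - k%:Z = b by lia.
by rewrite e eqxx mul1r.
Qed.

(** For fixed [k] and [b] the equation determines [q']. The [2 k + 1 <= 3 k] values of [b], each of
    weight at most [k^-3] because [m > 2], contribute at most [3 / k^2], and the sum of [1 / k^2] is
    at most 2. *)
Lemma sum_pair_weight K q G : (2 < m)%N -> uniq G ->
  \sum_(q' <- G) pair_weight K q q' <= 6.
Proof.
move=> m2 uG; rewrite exchange_big/=.
apply: (@le_trans _ _ (3 * \sum_(1 <= k < K.+1) (k%:R ^+ 2)^-1)); last first.
  by have := sum_inv_sqr_le2 R K; lra.
rewrite mulr_sumr; apply: ler_sum_nat => k /andP[k1 kK].
have k0 : 0 < k%:R :> R by rewrite ltr0n.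
rewrite exchange_big/=.
apply: (@le_trans _ _ (\sum_(0 <= b < (2 * k).+1) (k%:R ^+ m)^-1)).
  apply: ler_sum_nat => b _; rewrite -mulr_suml ler_piMl ?invr_ge0 ?exprn_ge0//.
  apply: sum_unique_le1 => // p p' /eqP e /eqP e'.
  apply/rowP => i; apply: (@mulfI _ k%:Z); first by lia.
  by have /rowP/(_ i) := etrans e (esym e'); rewrite !mxE.
rewrite sumr_const_nat subn0 -[leLHS]mulr_natl.
apply: (@le_trans _ _ ((3 * k%:R) * (k%:R ^+ 3)^-1)).
  apply: ler_pM => //; rewrite ?invr_ge0 ?exprn_ge0//.
    by rewrite -natrM ler_nat; lia.
  rewrite lef_pV2 ?posrE ?exprn_gt0//.
  by rewrite ler_weXn2l// ler1n.
by rewrite -mulrA ler_pM2l// exprS invfM mulrA divff ?mul1r// gt_eqF.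
Qed.

End pair_weight.

Section overlap.
Context {R : realType} {n m : nat} (y : 'rV[R]_m) (delta : 'rV[int]_n -> R).
Hypothesis delta01 : forall q, 0 <= delta q <= 1 / 2.
Hypothesis m_gt2 : (2 < m)%N.
Implicit Types (q : 'rV[int]_n) (G : seq 'rV[int]_n).

Let A q : set ((n * m).-tuple R) := approx y q (delta q).
Let v q := (2 * delta q) ^+ m.
Let w := @pair_weight R n m.

Let delta_ge0 q : 0 <= delta q. Proof. by case/andP: (delta01 q). Qed.
Let v_ge0 q : 0 <= v q. Proof. by rewrite exprn_ge0// mulr_ge0. Qed.

(** The power of the enlarged radius [delta q' + 1 / a] splits into [v q'] and [a^-m]; the second
    part is one term of the weight. *)
Let overlap_dep K (a b : int) q q' : q != 0 -> 0 < a -> coprimez a b ->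
  a *: q' = b *: q -> `|b| <= a -> a <= K%:Z ->
  (haar (A q `&` A q') <= (4 ^+ m * (v q * v q' + v q * w K q q'))%:E)%E.
Proof.
move=> q0 a0 ab e ba aK.
have aR : 0 < a%:~R^-1 :> R by rewrite invr_gt0 ltr0z.
apply: (le_trans (haar_approxI_dep y (delta q) q0 (delta_ge0 q') a0 ab e)).
rewrite haar_approx// -EFinM lee_fin -/(v q) -mulrDr mulrCA ler_wpM2l//.
have := pair_weight_ge (R := R) m a0 ba aK e; rewrite -/(w _ _ _) => wge.
apply: (@le_trans _ _ (4 ^+ m * (v q' + (a%:~R^-1) ^+ m))); last first.
  by rewrite ler_wpM2l ?exprn_ge0// lerD2l exprVn.
by rewrite /v exprDn_le4// ltW.
Qed.

(** In a proportional pair [a q' = b q] the larger of [a] and [|b|] has to be the denominator.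
    Either vector may be the one favoured, so both ordered weights appear. *)
Lemma overlap K q q' : q != 0 -> q' != 0 ->
  (forall i, `|q 0 i| <= K%:Z) -> (forall i, `|q' 0 i| <= K%:Z) ->
  (haar (A q `&` A q') <=
    (4 ^+ m * (v q * v q' + v q * w K q q' + v q' * w K q' q))%:E)%E.
Proof.
move=> q0 q'0 qK q'K.
have w0 p p' : 0 <= v p * w K p p' by rewrite mulr_ge0// pair_weight_ge0.
have [[i [k D0]]|[a [b [a0 b0 ab e [i [aq bq']]]]]] := row_dependent q0 q'0.
  apply: (le_trans (haar_approxI_indep y (delta q) (delta_ge0 q') D0)).
  rewrite haar_approx// -EFinM lee_fin -!/(v _).
  rewrite (@le_trans _ _ (1 * (v q * v q' + v q * w K q q' + v q' * w K q' q)))//.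
    by rewrite mul1r -addrA ler_wpDr// addr_ge0.
  apply: ler_wpM2r; first by rewrite !addr_ge0// mulr_ge0.
  by apply: exprn_ege1; lra.
have [ba|ba] := leP `|b| a.
  apply: (le_trans (overlap_dep q0 a0 ab e ba (le_trans aq (qK i)))).
  by rewrite lee_fin ler_wpM2l ?exprn_ge0// ler_wpDr.
(* Here [a < |b|]: the roles of [q] and [q'] are exchanged, with [|b|] as denominator and the sign
   of [b] moved onto [a]. *)
rewrite setIC.
have e' : `|b| *: q = (Num.sg b * a) *: q'.
  by rewrite -scalerA e scalerA normrEsg.
have bpos : 0 < `|b| by rewrite normr_gt0.
have ba' : coprimez `|b| (Num.sg b * a).
  rewrite coprimez_sym; move: ab.
  by rewrite !coprimezE abszM absz_sg b0 mul1n (_ : absz (Num.norm b) = absz b)//; lia.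
have le' : `|Num.sg b * a| <= `|b|.
  by rewrite normrM normr_sg b0 mul1r (gtr0_norm a0) ltW.
apply: (le_trans (overlap_dep q'0 bpos ba' e' le' (le_trans bq' (q'K i)))).
rewrite lee_fin ler_wpM2l ?exprn_ge0// (mulrC (v q')).
by rewrite -addrA lerD2l ler_wpDl.
Qed.

Lemma sum_overlap G : uniq G -> 0 \notin G ->
  (\sum_(q <- G) \sum_(q' <- G) haar (A q `&` A q') <=
   (4 ^+ m * ((\sum_(q <- G) v q) ^+ 2 + 12 * \sum_(q <- G) v q))%:E)%E.
Proof.
(* [K] bounds all entries of the vectors of [G], hence all denominators arising from their pairs. *)
move=> uG G0; pose K := (\max_(q <- G) \max_i absz (q ord0 i))%N.
have GK q i : q \in G -> `|q 0 i| <= K%:Z.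
  move=> qG; rewrite -abszE lez_nat /K (big_rem q)//= leq_max.
  by rewrite (leq_bigmax (F := fun i => absz (q 0 i))).
have Gn0 q : q \in G -> q != 0 by apply: contraTneq => ->.
apply: (@le_trans _ _ (\sum_(q <- G) \sum_(q' <- G)
    (4 ^+ m * (v q * v q' + v q * w K q q' + v q' * w K q' q))%:E)%E).
  rewrite big_seq [leRHS]big_seq; apply: lee_sum => q qG.
  rewrite big_seq [leRHS]big_seq; apply: lee_sum => q' q'G.
  by apply: overlap => [||i|i]; rewrite ?Gn0 ?GK.
under eq_bigr do rewrite sumEFin.
rewrite sumEFin lee_fin.
under eq_bigr do rewrite -mulr_sumr.
rewrite -mulr_sumr ler_wpM2l ?exprn_ge0//.
under eq_bigr do rewrite !big_split/=.
rewrite !big_split/= -addrA lerD//.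
  rewrite expr2 mulr_suml; apply: ler_sum => q _.
  by rewrite mulr_sumr.
(* Each of the two weight sums costs 6 times the sum of the [v q], whence the constant 12. *)
have half : \sum_(q <- G) \sum_(q' <- G) v q * w K q q' <= 6 * \sum_(q <- G) v q.
  rewrite mulr_sumr; apply: ler_sum => q _.
  by rewrite -mulr_sumr mulrC ler_wpM2r// sum_pair_weight.
have : \sum_(q <- G) \sum_(q' <- G) v q' * w K q' q <= 6 * \sum_(q <- G) v q.
  by rewrite exchange_big.
by move: half; lra.
Qed.

End overlap.

(** * Full measure *)

(* Integrate [f <= s f^2 + 1 / s] over [D], where [f] counts the sets [A i]. *)
Lemma sum_measureI_le d (T : measurableType d) (R : realType)
    (mu : {measure set T -> \bar R}) (I : Type) (G : seq I) (A : I -> set T)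
    (D : set T) (s : R) :
  (forall i, measurable (A i)) -> measurable D -> 0 < s ->
  (\sum_(i <- G) mu (A i `&` D) <=
    s%:E * (\sum_(i <- G) \sum_(j <- G) mu (A i `&` A j)) + s^-1%:E * mu D)%E.
Proof.
move=> mA mD s0.
have mI (B : set T) : measurable B -> measurable_fun setT (fun x => (\1_B x : R)%:E).
  by move=> mB; exact/measurable_EFinP.
have e1 : (\sum_(i <- G) mu (A i `&` D) =
    \int[mu]_x (\sum_(i <- G) (\1_(A i `&` D) x : R)%:E))%E.
  rewrite ge0_integral_sum//; last by move=> i; apply: mI; exact: measurableI.
  by apply: eq_bigr => i _; rewrite integral_indic ?setIT//; exact: measurableI.
have mII i : measurable_fun setT
    (fun x => (\sum_(j <- G) (\1_(A i `&` A j) x : R)%:E)%E).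
  by apply: emeasurable_sum => j; apply: mI; exact: measurableI.
have e2 : (\sum_(i <- G) \sum_(j <- G) mu (A i `&` A j) =
    \int[mu]_x (\sum_(i <- G) \sum_(j <- G) (\1_(A i `&` A j) x : R)%:E))%E.
  rewrite ge0_integral_sum//; last by move=> i x _; apply: sume_ge0.
  apply: eq_bigr => i _; rewrite ge0_integral_sum//; last first.
    by move=> j; apply: mI; exact: measurableI.
  by apply: eq_bigr => j _; rewrite integral_indic ?setIT//; exact: measurableI.
have e3 : (mu D = \int[mu]_x (\1_D x : R)%:E)%E by rewrite integral_indic ?setIT.
rewrite e1 e2 e3 -!ge0_integralZl//; last 5 first.
- exact: mI.
- by rewrite lee_fin invr_ge0 ltW.
- exact: emeasurable_sum.
- by move=> x _; apply: sume_ge0 => i _; exact: sume_ge0.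
- by rewrite lee_fin ltW.
rewrite -ge0_integralD//; last 4 first.
- move=> x _; apply: mule_ge0; first by rewrite lee_fin ltW.
  by apply: sume_ge0 => i _; exact: sume_ge0.
- by apply: measurable_funeM; exact: emeasurable_sum.
- by move=> x _; apply: mule_ge0; rewrite lee_fin// invr_ge0 ltW.
- by apply: measurable_funeM; exact: mI.
apply: ge0_le_integral => //.
- by move=> x _; exact: sume_ge0.
- by apply: emeasurable_sum => i; apply: mI; exact: measurableI.
- by apply: emeasurable_funD; apply: measurable_funeM;
    [exact: emeasurable_sum|exact: mI].
move=> x _; pose f := \sum_(i <- G) (\1_(A i) x : R).
have -> : (\sum_(i <- G) (\1_(A i `&` D) x : R)%:E = (f * \1_D x)%:E)%E.
  by rewrite sumEFin mulr_suml; congr (_%:E); apply: eq_bigr => i _; rewrite indicI.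
have -> : (\sum_(i <- G) \sum_(j <- G) (\1_(A i `&` A j) x : R)%:E = (f ^+ 2)%:E)%E.
  under eq_bigr do rewrite sumEFin.
  rewrite sumEFin expr2 mulr_suml; congr (_%:E); apply: eq_bigr => i _.
  by rewrite mulr_sumr; apply: eq_bigr => j _; rewrite indicI.
rewrite -!EFinM -EFinD lee_fin indicE; case: (x \in D); last first.
  by rewrite !mulr0 addr0 mulr_ge0 ?sqr_ge0// ltW.
rewrite !mulr1 -subr_ge0.
(* Completing the square in [s f]. *)
have -> : s * f ^+ 2 + s^-1 - f = s^-1 * ((s * f - 1 / 2) ^+ 2 + 3 / 4).
  by field; rewrite gt_eqF.
apply: mulr_ge0; first by rewrite invr_ge0 ltW.
by have := sqr_ge0 (s * f - 1 / 2); lra.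
Qed.

Section uncovered.
Context {R : realType} {n m : nat} (y : 'rV[R]_m) (delta : 'rV[int]_n -> R).
Implicit Types (q : 'rV[int]_n).
Local Notation "q ^R" := (map_mx intr q : 'rV[R]_n) (at level 2, format "q ^R").

Let A q : set ((n * m).-tuple R) := approx y q (delta q).
(** Moving every entry of [X] by at most [r] moves each coordinate of [q X] by at most
    [r * norm1 q]. *)
Let norm1 q : R := \sum_i `|(q 0 i)%:~R|.

(* If [X] lies in this set then all points within [r] of [X] lie in some [A q].
   Shrinking the radii in this way avoids neighbourhoods of sets; negative radii
   give empty sets. *)
Definition shrunk_cover k (r : R) : set ((n * m).-tuple R) :=
  \bigcup_(q in [set q | (k <= choice.pickle q)%N])
    approx y q (delta q - r * norm1 q).

Lemma measurable_shrunk_cover k r : measurable (shrunk_cover k r).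
Proof.
rewrite /shrunk_cover bigcup_mkcond.
apply: countable_bigcupT_measurable => [|q]; first exact: countableP.
by case: ifP => // _; exact: measurable_approx.
Qed.

Lemma periodic_shrunk_cover k r : periodic (~` shrunk_cover k r).
Proof.
move=> z t ut [q kq Aq]; apply: ut; exists q => //.
rewrite (_ : t = shift (fun i => (- z i)%:~R) (shift (fun i => (z i)%:~R) t)).
  exact: periodic_approx.
by apply/eq_from_tnth => i; rewrite !tnth_mktuple rmorphN addrK.
Qed.

Lemma shrunk_cover_le k r s : s <= r -> shrunk_cover k r `<=` shrunk_cover k s.
Proof.
move=> sr X [q kq Aq]; exists q => // j; apply: near_le (Aq j).
by rewrite lerB// ler_wpM2r// sumr_ge0.
Qed.

(** The conditions are strict and finite in number for each [q], so a point of the cover has a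
    positive slack [r]; it survives shrinking once [norm1 q / N.+1 <= r]. *)
Lemma bigcup_shrunk_cover k : (0 < m)%N ->
  \bigcup_j shrunk_cover k j.+1%:R^-1 = shrunk_cover k 0.
Proof.
move=> m0; apply/seteqP; split => X.
  by move=> [j _]; apply: shrunk_cover_le; rewrite invr_ge0.
move=> [q kq]; rewrite mul0r subr0 => Aq.
have n1 : 0 <= norm1 q by exact: sumr_ge0.
have [r r0 Ar] : exists2 r, 0 < r & forall j, near_coset (y 0 j) (delta q - r)
    (tnth (linear_forms q X) j).
  have /choice[r hr] : forall j, exists r, 0 < r /\
      near_coset (y 0 j) (delta q - r) (tnth (linear_forms q X) j).
    by move=> j; have [r r0 Nr] := near_open (Aq j); exists r.
  exists (\big[Num.min/1]_j r j).
    by elim/big_ind : _ => // [a b a0 b0|j _]; [rewrite lt_min a0|case: (hr j)].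
  move=> j; apply: near_le (hr j).2; rewrite lerB//.
  exact: bigmin_le_cond.
pose N := Num.truncn ((norm1 q + 1) / r).
exists N => //; exists q => // j; apply: near_le (Ar j); rewrite lerB//.
have N0 : 0 < N.+1%:R :> R by rewrite ltr0n.
have : (norm1 q + 1) / r < N.+1%:R by rewrite truncnS_gt.
by rewrite ltr_pdivrMr// ler_pdivrMl// => h; lra.
Qed.

(* Every translation is close to one preserving [A q]. *)
Lemma haar_approx_mixing k r q i : 0 < r -> 1 <= r * `|(q 0 i)%:~R| ->
  (haar (A q) * haar (~` shrunk_cover k 0) <=
   haar (A q `&` ~` shrunk_cover k r))%E.
Proof.
move=> r0 rq.
have mC s := measurableC (measurable_shrunk_cover k s).
have qi0 : (q 0 i)%:~R != 0 :> R.
  by apply: contraTneq rq => ->; rewrite normr0 mulr0 -ltNge ltr01.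
apply: (@haar_transport_ge R _ _ id (@measurable_id _ _ _) (A q)
  (~` shrunk_cover k 0) (~` shrunk_cover k r)) => //.
- exact: measurable_approx.
- exact: periodic_shrunk_cover.
- by apply: periodicI; [exact: periodic_approx|exact: periodic_shrunk_cover].
move=> z; pose Z0 : 'M[R]_(n, m) := vec_mx (\row_i z i).
(* [f] is the fractional part of [q Z0]. Subtracting [f / q_i] from row [i] of [Z0] makes [q Z]
   integral, so [Z] preserves [A q], and changes each entry by at most [1 / |q_i| <= r]. *)
pose f := q^R *m Z0 - \row_j (Num.floor ((q^R *m Z0) 0 j))%:~R.
pose Z := Z0 - ((q 0 i)%:~R^-1 *: delta_mx i 0) *m f.
exists (fun i => mxvec Z 0 i) => X AX; rewrite shift_mxE -/Z0 => EX.
have fractional j : 0 <= f 0 j < 1.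
  have := ge_floor ((q^R *m Z0) 0 j); have := floorD1_gt ((q^R *m Z0) 0 j).
  have -> : f 0 j = (q^R *m Z0) 0 j - (Num.floor ((q^R *m Z0) 0 j))%:~R.
    by rewrite [LHS]mxE; congr (_ + _); rewrite 2!mxE.
  by rewrite rmorphD/= => h1 h2; lra.
split.
  rewrite /A /approx/= linear_forms_shift.
  have -> : q^R *m Z = \row_j (Num.floor ((q^R *m Z0) 0 j))%:~R.
    rewrite mulmxBr mulmxA -scalemxAr -colE (_ : _ *: _ = 1%:M) ?mul1mx.
      by rewrite /f opprB addrC subrK.
    by apply/rowP => l; rewrite !mxE mulVf// [l]ord1 eqxx.
  by rewrite row_funK near_box_shiftz.
(* If the translate by [Z] met the shrunk cover, the nearby translate by [Z0] would meet the full
   one. *)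
move=> [q2 kq2 Aq2]; apply: EX; exists q2 => // j.
rewrite mul0r subr0 linear_forms_shift tnth_mktuple.
have := Aq2 j; rewrite -/(mx_shift _ X) linear_forms_shift tnth_mktuple => Nj.
rewrite -(subrK (r * norm1 q2) (delta q2)).
apply: (@near_shift _ _ _ _ 0 _ _ _ Nj).
have e : (q2^R *m Z0) 0 j - (q2^R *m Z) 0 j = (q2 0 i)%:~R * ((q 0 i)%:~R^-1 * f 0 j).
  rewrite mulmxBr mulmxA -scalemxAr -colE.
  rewrite [X in _ - X]mxE [X in _ - (_ + X)]mxE opprD opprK addrA subrr add0r.
  by rewrite mxE big_ord1 !mxE; ring.
rewrite subr0 opprD addrACA subrr add0r e normrM mulrC.
have q2n : `|(q2 0 i)%:~R| <= norm1 q2 by exact: (ler_sum_seq1 (mem_index_enum i)).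
apply: ler_pM => //; rewrite normrM normfV.
have /andP[f0 f1] := fractional j; rewrite (ger0_norm f0).
rewrite ler_pdivrMl ?normr_gt0// mulrC; lra.
Qed.

End uncovered.

Section uncovered_null.
Context {R : realType} {n m : nat} (y : 'rV[R]_m) (delta : 'rV[int]_n -> R).
Hypothesis delta01 : forall q, 0 <= delta q <= 1 / 2.
Hypothesis m_gt2 : (2 < m)%N.
Implicit Types (q : 'rV[int]_n) (G : seq 'rV[int]_n).

Let A q : set ((n * m).-tuple R) := approx y q (delta q).
Let v q := (2 * delta q) ^+ m.
Let cover k r := shrunk_cover y delta k r.

(** Mixing bounds [V] times the uncovered measure by the sum of the measures of [A q] inside the gap
    between the two covers; the second moment bounds that sum. *)
Lemma haar_uncovered_le k r tau G : 0 < r -> 0 < tau -> uniq G ->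
  {in G, forall q, (k <= choice.pickle q)%N /\
    exists i, 1 <= r * `|(q 0 i)%:~R|} ->
  1 <= \sum_(q <- G) v q ->
  (haar (~` cover k 0) <= (13 * 4 ^+ m * tau)%:E +
    tau^-1%:E * haar (~` cover k r `&` cover k 0))%E.
Proof.
move=> r0 tau0 uG GP; set V := \sum_(q <- G) v q => V1.
have V0 : 0 < V by lra.
have mC s : measurable (cover k s) by exact: measurable_shrunk_cover.
have mD : measurable (~` cover k r `&` cover k 0).
  by apply: measurableI => //; exact: measurableC.
have mA q : measurable (A q) by exact: measurable_approx.
have Gn0 q : q \in G -> q != 0.
  move=> /GP[_ [i]]; apply: contraTneq => ->.
  by rewrite mxE normr0 mulr0 -ltNge ltr01.
have fin B : measurable B -> haar (d := n * m) (R := R) B \is a fin_num.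
  by move=> mB; rewrite fin_num_measure.
have each q : q \in G ->
    ((v q)%:E * haar (~` cover k 0) <=
     haar (A q `&` (~` cover k r `&` cover k 0)))%E.
  move=> qG; have [kq [i rq]] := GP q qG.
  rewrite -(haar_approx y (Gn0 q qG) (delta01 q)).
  apply: le_trans (haar_approx_mixing y delta k r0 rq) _.
  rewrite le_eqVlt; apply/orP; left; apply/eqP; congr haar.
  apply/seteqP; split => X [AX]; last by case.
  move=> DX; split=> //; split=> //; exists q => //.
  by rewrite mul0r subr0.
(* With the parameter [tau / V], division by [V] leaves [4^m tau (1 + 12 / V)] plus the gap over
   [tau]; [V >= 1] turns [1 + 12 / V] into the constant 13. *)
have sum_le : (V%:E * haar (~` cover k 0) <=
    (tau / V)%:E * (\sum_(q <- G) \sum_(q' <- G) haar (A q `&` A q')) +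
    (tau / V)^-1%:E * haar (~` cover k r `&` cover k 0))%E.
  apply: le_trans (sum_measureI_le _ G mA mD _); last by rewrite divr_gt0.
  rewrite /V -sumEFin ge0_sume_distrl; last first.
    by move=> q _; rewrite lee_fin exprn_ge0// mulr_ge0//; case/andP: (delta01 q).
  by rewrite big_seq [leRHS]big_seq; apply: lee_sum => q /each.
have G0 : 0 \notin G by apply/negP => /Gn0; rewrite eqxx.
have pairs := sum_overlap y delta01 m_gt2 uG G0.
move: sum_le.
rewrite -(fineK (fin _ mD)) -(fineK (fin _ (measurableC (mC 0)))) => sum_le.
have : (V%:E * (fine (haar (~` cover k 0)))%:E <=
    (tau / V)%:E * (4 ^+ m * (V ^+ 2 + 12 * V))%:E + (tau / V)^-1%:E *
     (fine (haar (~` cover k r `&` cover k 0)))%:E)%E.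
  apply: (le_trans sum_le); apply: leeD => //.
  by apply: lee_wpmul2l pairs; rewrite lee_fin divr_ge0// ltW.
rewrite -!EFinM -!EFinD !lee_fin.
set a := fine (haar (~` cover k 0)); set b := fine _.
have -> : tau / V * (4 ^+ m * (V ^+ 2 + 12 * V)) + (tau / V)^-1 * b =
    V * (4 ^+ m * tau * (1 + 12 / V) + tau^-1 * b).
  by field; rewrite !gt_eqF.
rewrite ler_pM2l// => h; apply: (le_trans h); rewrite lerD2r.
rewrite -[leRHS]mulrA [leRHS]mulrC; apply: ler_wpM2l.
  by apply: mulr_ge0; [exact: exprn_ge0|exact: ltW].
have : 12 / V <= 12 by rewrite ler_pdivrMr//; lra.
lra.
Qed.

Hypothesis divergent : forall (F : set 'rV[int]_n) (T : R), finite_set F ->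
  exists G, [/\ uniq G, {in G, forall q, ~ F q} & T <= \sum_(q <- G) v q].

Lemma finite_pickle_lt (T : countType) k :
  finite_set [set x : T | (choice.pickle x < k)%N].
Proof.
apply: (@sub_finite_set _ _ [set` pmap (@choice.unpickle T) (iota 0 k)]) => //.
move=> x /= xk; rewrite mem_pmap; apply/mapP; exists (choice.pickle x).
  by rewrite mem_iota.
by rewrite choice.pickleK.
Qed.

Lemma finite_bounded_row (N : nat) :
  finite_set [set q : 'rV[int]_n | forall i, `|q 0 i| <= N%:Z].
Proof.
pose f (t : 'rV['I_(2 * N).+1]_n) : 'rV[int]_n := \row_i ((t 0 i)%:Z - N%:Z).
apply: (@sub_finite_set _ _ (f @` setT)); last first.
  by apply: finite_image; exact: finite_finset.
move=> q qN; exists (\row_i inord (absz (q 0 i + N%:Z))) => //.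
apply/rowP => i; rewrite !mxE; have := qN i => qi.
by rewrite inordK; lia.
Qed.

(** The gaps [D j] decrease to the empty set, so their measures tend to 0, and [tau] is
    arbitrary. *)
Lemma haar_uncovered k : haar (~` cover k 0) = 0%E.
Proof.
have m0 : (0 < m)%N by lia.
pose D j := ~` cover k j.+1%:R^-1 `&` cover k 0.
have mC s : measurable (cover k s) by exact: measurable_shrunk_cover.
have mD j : measurable (D j) by apply: measurableI => //; exact: measurableC.
have D0 : \bigcap_j D j = set0.
  rewrite -subset0 => X DX.
  have [_] := DX 0 Logic.I; rewrite /cover -bigcup_shrunk_cover// => -[j _].
  by have [] := DX j Logic.I.
have Dcvg : haar (D j) @[j --> \oo] --> 0%E.
  rewrite -(measure0 (@haar R (n * m))) -D0.
  apply: nonincreasing_cvg_mu => //.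
  - by rewrite ltey_eq fin_num_measure.
  - by rewrite D0; exact: measurable0.
  - move=> i j ij; apply/subsetPset; apply: setSI; apply: subsetC.
    by apply: shrunk_cover_le; rewrite lef_pV2 ?posrE// ler_nat.
have small (tau : R) : 0 < tau -> (haar (~` cover k 0) <= ((13 * 4 ^+ m + 1) * tau)%:E)%E.
  move=> tau0.
  (* The square leaves a factor [tau] after the multiplication by [tau^-1]. *)
  have [j hj] : exists j, (haar (D j) <= (tau ^+ 2)%:E)%E.
    apply: contrapT => /forallNP h.
    suff : ((tau ^+ 2)%:E <= 0 :> \bar R)%E by rewrite lee_fin leNgt exprn_gt0.
    rewrite -(cvg_lim _ Dcvg)//; apply: lime_ge; first by apply/cvg_ex; exists 0%E.
    by apply: nearW => j; apply/ltW; rewrite ltNge; apply/negP/h.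
  (* A vector outside [F] takes part in the cover and has an entry of size at least [j + 1], as
     mixing with [r = 1 / (j + 1)] requires. *)
  pose F := [set q : 'rV[int]_n | (choice.pickle q < k)%N] `|`
    [set q : 'rV[int]_n | forall i, `|q 0 i| <= j%:Z].
  have Ffin : finite_set F.
    by rewrite finite_setU; split; [exact: finite_pickle_lt|exact: finite_bounded_row].
  have [G [uG GF GV]] := divergent 1 Ffin.
  have j0 : 0 < j.+1%:R^-1 :> R by rewrite invr_gt0.
  apply: le_trans (haar_uncovered_le (k := k) j0 tau0 uG _ GV) _.
    move=> q /GF; rewrite /F => /not_orP[/negP kq /existsNP[i /negP qi]].
    split; first by rewrite leqNgt.
    exists i; rewrite mulrC ler_pdivlMr// mul1r -intr_norm [j.+1%:R]pmulrn ler_int; lia.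
  rewrite (mulrDl (13 * 4 ^+ m)) mul1r EFinD; apply: leeD => //.
  have -> : tau%:E = (tau^-1%:E * (tau ^+ 2)%:E)%E.
    by rewrite -EFinM; congr (_%:E); field; rewrite gt_eqF.
  by apply: lee_wpmul2l => //; rewrite lee_fin invr_ge0 ltW.
have C0 : 0 < 13 * 4 ^+ m + 1 :> R by rewrite ltr_pwDr// mulr_ge0// exprn_ge0.
apply/eqP; rewrite eq_le measure_ge0 andbT; apply/lee_addgt0Pr => e e0.
rewrite add0e; have := small (e / (13 * 4 ^+ m + 1)).
by rewrite divr_gt0// mulrCA divff ?gt_eqF// mulr1; exact.
Qed.

End uncovered_null.

Lemma infinite_set_pickle (T : countType) (B : set T) :
  infinite_set B <-> forall k, exists2 x, (k <= choice.pickle x)%N & B x.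
Proof.
split=> [infB k|Bk finB].
  apply: contrapT => h; apply: infB.
  apply: sub_finite_set (@finite_pickle_lt T k) => x Bx /=.
  by rewrite ltnNge; apply/negP => kx; apply: h; exists x.
have [s sB] : exists s : seq T, B = [set` s] by apply/finite_seqP.
have [x kx Bx] := Bk (\max_(z <- s) choice.pickle z).+1.
have xs : x \in s by move: Bx; rewrite sB.
by move: kx; rewrite ltnNge (leq_bigmax_seq (F := choice.pickle)).
Qed.

(** * The limit superior set and its image in the torus *)

Section limsup_approx.
Context {R : realType} {n m : nat} (y : 'rV[R]_m) (psi : 'rV[int]_n -> R).

Definition limsup_approx : set ((n * m).-tuple R) :=
  \bigcap_k shrunk_cover y psi k 0.

Lemma limsup_approxE t : limsup_approx t <->
  infinite_set [set q | approx y q (psi q) t].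
Proof.
rewrite infinite_set_pickle; split=> h k.
  by have [q kq] := h k Logic.I; rewrite mul0r subr0; exists q.
by move=> _; have [q kq hq] := h k; exists q => //; rewrite mul0r subr0.
Qed.

Lemma measurable_limsup_approx : measurable limsup_approx.
Proof. by apply: bigcap_measurable => // k _; exact: measurable_shrunk_cover. Qed.

End limsup_approx.

Section torus_limsup.
Local Open Scope quotient_scope.
Context {R : realType} {n m : nat} (y : 'rV[R]_m) (psi : 'rV[int]_n -> R).
Local Notation "q ^R" := (map_mx intr q : 'rV[R]_n) (at level 2, format "q ^R").

Lemma near_boxE (delta : R) (u : 'rV[R]_m) : (0 < m)%N ->
  [set b + c | b in ball 0 delta & c in shifted_lattice y] u <->
  forall j, near_coset (y 0 j) delta (u 0 j).
Proof.
move=> m0; split.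
  move=> [b [_ b0] [_ [p _ <-] <-]] j; exists (p 0 j).
  have := b0 ord0 j; rewrite /ball/= !mxE sub0r normrN.
  by rewrite (_ : b 0 j + _ - _ - _ = b 0 j)//; ring.
move=> h; have /choice[p hp] := h.
exists (u - (y + map_mx intr (\row_j p j))).
  (* Membership in a ball of matrices includes positivity of the radius, which any one coordinate
     supplies. *)
  split; first by have := hp (Ordinal m0); exact: le_lt_trans.
  move=> i j; rewrite [i]ord1 /ball/= !mxE sub0r normrN opprD addrA.
  exact: hp.
by exists (y + map_mx intr (\row_j p j)); [exists (\row_j p j)|rewrite subrK].
Qed.

(** The defining condition [S] is invariant under integer matrices, so pulling its image in the
    torus back to the unit cube gives [S] itself. *)
Lemma lebesgue_torus_W (P : 'rV[int]_n -> set 'rV[R]_m) : (0 < m)%N ->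
  (forall q, P q = shifted_lattice y) ->
  lebesgue_torus (@W R n m P psi) = haar (limsup_approx y psi).
Proof.
move=> m0 PE; pose S := [set X : 'M[R]_(n, m) |
  infinite_set [set q | forall j, near_coset (y 0 j) (psi q) ((q^R *m X) 0 j)]].
have WE : W P psi = \pi_(torus R n m) @` S.
  rewrite /W; congr image; apply/funext => X; rewrite /S/=; congr (~ finite_set _).
  by apply/funext => q /=; rewrite PE; apply/propext/near_boxE.
have S_inv X X' : eqmodZ X X' -> S X -> S X'.
  move=> /mxOverP XX'; rewrite /S/=.
  rewrite (_ : [set q | _] =
      [set q | forall j, near_coset (y 0 j) (psi q) ((q^R *m X') 0 j)])//.
  have XX'q q j : exists k : int, (q^R *m X) 0 j = (q^R *m X') 0 j + k%:~R.
    have /intrP[k kE] : (q^R *m (X - X')) 0 j \is a Num.int.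
      by rewrite mxE rpred_sum// => i _; rewrite rpredM// mxE intr_int.
    by exists k; rewrite -kE mulmxBr [X in _ + X]mxE [X in _ + (_ + X)]mxE addrC subrK.
  by apply/seteqP; split => q /= h j; have := h j; have [k ->] := XX'q q j;
    rewrite near_addz.
have St t : S (mx_of_tuple t) <-> limsup_approx y psi t.
  rewrite limsup_approxE /S/=.
  rewrite (_ : [set q | forall j, _] = [set q | approx y q (psi q) t])//.
  by apply/seteqP; split => q /= h j; have := h j; rewrite tnth_mktuple.
rewrite /lebesgue_torus /haar /mrestr; congr (lebesgue_tuple R _ _).
apply/seteqP; split => t /=; rewrite WE.
  move=> [ct [X SX /eqmodP XX']]; split=> //.
  by apply/St; exact: S_inv SX.
by move=> [/St tS ct]; split=> //; exists (mx_of_tuple t).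
Qed.

End torus_limsup.

(** * The convergent and the divergent case *)

Section zero_one.
Context {R : realType} {n m : nat} (y : 'rV[R]_m) (psi : 'rV[int]_n -> R).
Hypothesis psi_ge0 : forall q, 0 <= psi q.

Lemma haar_limsup_convergent :
  (\esum_(q in [set: 'rV[int]_n]) (psi q ^+ m)%:E < +oo)%E ->
  haar (limsup_approx y psi) = 0%E.
Proof.
move=> psi_oo.
(* The bound [haar_approx_le] is for nonzero [q]; dropping [q = 0] does not affect the limit
   superior. *)
pose term (q : 'rV[int]_n) : set ((n * m).-tuple R) :=
  if q == 0 then set0 else approx y q (psi q).
pose B i := if choice.pickle_inv i is Some q then term q else set0.
have mterm q : measurable (term q).
  by rewrite /term; case: ifP => // _; exact: measurable_approx.
have mB i : measurable (B i) by rewrite /B; case: choice.pickle_inv.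
have B0 : haar (lim_sup_set B) = 0%E.
  apply: lim_sup_set_cvg0 => //; rewrite nneseries_esumT//.
  have -> : (\esum_(i in [set: nat]) haar (B i) =
      \esum_(i in range (@choice.pickle 'rV[int]_n)) haar (B i))%E.
    rewrite [RHS]esum_mkcond; apply: eq_esum => i _; case: ifPn => // /negP h.
    rewrite /B; case E : (choice.pickle_inv i) => [q|]; last by rewrite measure0.
    exfalso; apply: h; rewrite inE; exists q => //.
    by have := @choice.pickle_invK 'rV[int]_n i; rewrite E.
  rewrite (@reindex_esum R _ _ setT _ (@choice.pickle 'rV[int]_n)); last first.
    by apply: inj_bij => q q' _ _; exact: (pcan_inj (@choice.pickleK _)).
  apply: (@le_lt_trans _ _ (\esum_(q in [set: 'rV[int]_n]) ((2 ^+ m)%:E * (psi q ^+ m)%:E)))%E.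
    apply: le_esum => q _; rewrite /B choice.pickleK_inv /term.
    case: eqP => [_|/eqP q0]; first by rewrite measure0 mule_ge0// lee_fin exprn_ge0.
    by rewrite -EFinM -exprMn; exact: haar_approx_le.
  apply: (@le_lt_trans _ _ ((2 ^+ m)%:E * \esum_(q in [set: 'rV[int]_n]) (psi q ^+ m)%:E))%E.
    apply: ge_ereal_sup => _ [X [finX XT] <-].
    rewrite fsbig_finite//= -ge0_sume_distrr; last first.
      by move=> q _; rewrite lee_fin exprn_ge0.
    rewrite lee_wpmul2l ?lee_fin ?exprn_ge0// -fsbig_finite//.
    by apply: esum_ge; exists X.
  by rewrite lte_mul_pinfty// lee_fin exprn_ge0.
apply/eqP; rewrite eq_le measure_ge0 andbT -B0; apply: le_measure; rewrite ?inE.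
- exact: measurable_limsup_approx.
- by apply: bigcap_measurable => // k _; exact: bigcup_measurable.
(* Starting beyond the code of the zero vector forces [q] to be nonzero. *)
move=> t ht k _; have [q kq] := ht (maxn k (choice.pickle (0 : 'rV[int]_n)).+1) Logic.I.
rewrite mul0r subr0 => hq; rewrite /= geq_max in kq; have /andP[kq1 kq2] := kq.
exists (choice.pickle q) => //; rewrite /B choice.pickleK_inv /term.
by case: eqP => // q0; rewrite q0 ltnn in kq2.
Qed.

Lemma haar_limsup_divergent : (2 < m)%N ->
  (\esum_(q in [set: 'rV[int]_n]) (psi q ^+ m)%:E = +oo)%E ->
  haar (limsup_approx y psi) = 1%E.
Proof.
move=> m2 psi_oo; pose delta q := Num.min (psi q) (1 / 2).
have delta01 q : 0 <= delta q <= 1 / 2.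
  by rewrite /delta le_min psi_ge0 ge_min lexx orbT andbT; lra.
have divergent (F : set 'rV[int]_n) (T : R) : finite_set F -> exists G,
    [/\ uniq G, {in G, forall q, ~ F q} & T <= \sum_(q <- G) (2 * delta q) ^+ m].
  move=> finF; pose L := [set q | 1 / 2 < psi q].
  (* If [psi > 1/2] only finitely often, these vectors are discarded together with [F]; elsewhere
     [delta = psi], and a finite part of the divergent remainder exceeds [T]. Otherwise infinitely
     many terms [(2 delta)^m] equal 1. *)
  have [finL|infL] := pselect (finite_set L).
    pose F' := F `|` L.
    have finF' : finite_set F' by rewrite finite_setU.
    have term_ge0 q : (0 <= (psi q ^+ m)%:E)%E by rewrite lee_fin exprn_ge0.
    have : (T%:E < \esum_(q in ~` F') (psi q ^+ m)%:E)%E.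
      move: psi_oo; rewrite (esumID F')// !setTI => h.
      have : (\esum_(q in F') (psi q ^+ m)%:E < +oo)%E.
        by rewrite esum_fset// fsbig_finite//= sumEFin ltry.
      move: h; case: (esum (~` F') _) (esum_ge0 (S := ~` F') (fun q _ => term_ge0 q)) => [r||]//.
        by case: (esum _ _).
      by rewrite ltry.
    move=> /ereal_sup_gt[_ [X [finX XF'] <-]].
    rewrite fsbig_finite//= sumEFin lte_fin => TX.
    exists (finmap.enum_fset (fset_set X)); split.
    - exact: finmap.fset_uniq.
    - by move=> q; rewrite in_fset_set// inE => /XF' + Fq; apply; left.
    apply: (le_trans (ltW TX)); rewrite big_seq [leRHS]big_seq.
    apply: ler_sum => q; rewrite in_fset_set// inE => /XF' qF'.
    have q2 : psi q <= 1 / 2 by rewrite leNgt; apply/negP => h; apply: qF'; right.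
    rewrite /delta min_l//; apply: lerXn2r; rewrite ?nnegrE ?mulr_ge0//.
    by have := psi_ge0 q; lra.
  have infLF : infinite_set (L `\` F) by exact: infinite_setD.
  have [X XLF XT] := infinite_set_fset (Num.truncn T).+1 infLF.
  exists (finmap.enum_fset X); split; first exact: finmap.fset_uniq.
    by move=> q qX; have [] := XLF q qX.
  rewrite big_seq (eq_bigr (fun=> 1%:R)); last first.
    move=> q qX; have [Lq _] := XLF q qX.
    by rewrite /delta min_r ?ltW// mulrCA divff// mulr1 expr1n.
  rewrite -big_seq -natr_sum sum1_size.
  apply: (@le_trans _ _ (Num.truncn T).+1%:R); first exact/ltW/truncnS_gt.
  by rewrite ler_nat.
have unc k := haar_uncovered y delta01 m2 divergent k.
have null : haar (~` limsup_approx (n := n) y psi) = 0%E.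
  apply: measure_negligible.
    by apply: measurableC; exact: measurable_limsup_approx.
  (* As [delta <= psi], a point outside the limit superior for [psi] is missed by one of the covers
     for [delta]. *)
  have : (@haar R (n * m)).-negligible (\bigcup_k ~` shrunk_cover y delta k 0).
    apply: negligible_bigcup => k; apply/negligibleP; last exact: unc.
    by apply: measurableC; exact: measurable_shrunk_cover.
  apply: negligibleS; rewrite -setC_bigcap; apply: subsetC => t ht k _.
  have [q kq hq] := ht k Logic.I; exists q => // j; apply: near_le (hq j).
  by rewrite !mul0r !subr0 /delta ge_min lexx.
have mC : measurable (~` limsup_approx (n := n) y psi).
  by apply: measurableC; exact: measurable_limsup_approx.
rewrite -[X in haar X]setCK.
transitivity (1 - haar (~` limsup_approx (n := n) y psi))%E; last by rewrite null sube0.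
exact: (probability_setC (@haar R (n * m)) mC).
Qed.

End zero_one.

Unset Implicit Arguments.

Theorem theorem2p3 (R : realType) (m n : nat) (n_gt0 : (0 < n)%N)
    (m_gt2 : (2 < m)%N) (y : 'rV[R]_m) (P : 'rV[int]_n -> set 'rV[R]_m)
    (PE : forall q, P q = shifted_lattice y)
    (psi : 'rV[int]_n -> R) (psi_ge0 : forall q, 0 <= psi q) :
  ((\esum_(q in [set: 'rV[int]_n]) (psi q ^+ m)%:E < +oo)%E ->
    lebesgue_torus (W P psi) = 0%E) /\
  ((\esum_(q in [set: 'rV[int]_n]) (psi q ^+ m)%:E = +oo)%E ->
    lebesgue_torus (W P psi) = 1%E).
Proof.
have m_gt0 : (0 < m)%N by exact: leq_trans m_gt2.
rewrite (lebesgue_torus_W psi m_gt0 PE); split.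
  exact: haar_limsup_convergent.
exact: haar_limsup_divergent.
Qed.
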